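(* Let $\mathcal X_T=(X_1,\ldots,X_T)$ be given vectors in $\mathbb R^p$ and let $\epsilon>0$. For $\lambda_1>0$, $\lambda_2>0$ consider the primal problem $$\text{(P)}\quad\min_{\Theta_t\succeq\epsilon I_p,\ 1\le t\le T}\Big\{\sum_{t=1}^T\big[\mathrm{tr}(\tfrac12\Theta_t^2X_tX_t^\top)-\mathrm{tr}(\Theta_t)\big]+\lambda_1T\sum_{t=1}^T\|\Theta_t\|_{1,\mathrm{off}}+\lambda_2T\sum_{t=1}^{T-1}\|\Theta_{t+1}-\Theta_t\|_F\Big\}.$$ (i) The dual problem of (P) is $$\text{(D)}\quad\begin{aligned}\max_{\mathbf Y}\quad&\sum_{t=1}^T-\tfrac12\mathrm{tr}(W_t^\top W_t)+\epsilon\sum_{t=1}^T\mathrm{tr}\big(Z_t-Z_{t-1}-I_p+(X_tX_t^\top)^{1/2}W_t-Y_{t,\mathrm{off}}\big)\\ \text{s.t.}\quad&Z_0=Z_T=\mathbf 0_{p\times p},\\&Z_t-Z_{t-1}-I_p+\mathrm{Sym}\big((X_tX_t^\top)^{1/2}W_t\big)-Y_{t,\mathrm{off}}\succeq0\quad\forall t=1,\ldots,T,\\&\|Z_t\|_F\le\lambda_2T,\quad|Y_{uv,t}|\le\lambda_1T\quad\forall t=1,\ldots,T,\ u,v=1,\ldots,p\text{ with }u\ne v,\end{aligned}$$ where $\mathbf Y=\{\{W_t\}_{t=1}^T,\{Y_{t,\mathrm{off}}\}_{t=1}^T,\{Z_t\}_{t=1}^{T-1}\}$ is the dual variable, with $W_t\in\mathbb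 R^{p\times p}$, $Y_{t,\mathrm{off}}\in\mathcal S^p_{\mathrm{off}}$, $Z_t\in\mathcal S^p$ for all $t$. Moreover, the optimal values of (P) and (D) are the same. (ii) If $\sum_{t=1}^TX_tX_t^\top\succ0$, then there exists $\overline\lambda_2>0$ such that for any $\lambda_1>0$ and any $\lambda_2\ge\overline\lambda_2$, the dual problem (D) has a Slater point and the primal problem (P) has optimal solutions.
   Context: $\mathcal S^p$ is the set of symmetric $p\times p$ matrices; $\mathcal S^p_{\mathrm{off}}$ is the set of symmetric $p\times p$ matrices with zero diagonal; $Y_{uv,t}$ is the $(u,v)$ entry of $Y_{t,\mathrm{off}}$. $A\succeq B$ (resp. $A\succ B$) means $A,B$ are symmetric and $A-B$ is positive semi-definite (resp. positive definite). $\mathrm{Sym}(A)=(A+A^\top)/2$. $S^{1/2}$ is the unique positive semi-definite square root of a positive semi-definite $S$. $\|A\|_{1,\mathrm{off}}=\sum_{k\ne l}|A_{kl}|$; $\|\cdot\|_F$ is the Frobenius norm. ''Dual problem'' means the Lagrangian dual (with multipliers $W_t$, $Y_{t,\mathrm{off}}$, $Z_t$) of the equivalent form of (P) obtained by introducing auxiliary variables and the equality constraints $U_t=(X_tX_t^\top)^{1/2}\Theta_t$, $\Upsilon_{t,\mathrm{off}}=\Theta_{t,\mathrm{off}}$ (for $t=1,\ldots,T$) and $D_t=\Theta_{t+1}-\Theta_t$ (for $t=1,\ldots,T-1$), where $\Theta_{t,\mathrm{off}}$ is $\Theta_t$ with diagonal set to $0$, $\Upsilon_{t,\mathrm{off}}\in\mathcal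 S^p_{\mathrm{off}}$, $D_t\in\mathcal S^p$, $U_t\in\mathbb R^{p\times p}$; the objective becomes $\sum_t[\frac12\mathrm{tr}(U_t^\top U_t)-\mathrm{tr}(\Theta_t)+\delta_{\cdot\succeq\epsilon I_p}(\Theta_t)]+\lambda_1T\sum_t\|\Upsilon_{t,\mathrm{off}}\|_{1,\mathrm{off}}+\lambda_2T\sum_{t=1}^{T-1}\|D_t\|_F$, with $\delta_{\cdot\succeq\epsilon I_p}$ the indicator function ($0$ on $\{S:S\succeq\epsilon I_p\}$, $+\infty$ elsewhere), and the Lagrangian subtracts $\langle W_t,U_t-(X_tX_t^\top)^{1/2}\Theta_t\rangle$, $\langle Y_{t,\mathrm{off}},\Theta_{t,\mathrm{off}}-\Upsilon_{t,\mathrm{off}}\rangle$, $\langle Z_t,\Theta_{t+1}-\Theta_t-D_t\rangle$. Optimal values are in $[-\infty,+\infty]$ (an infeasible maximization problem has value $-\infty$). A Slater point of (D) is a feasible point that satisfies all the inequality and positive semi-definite constraints strictly, i.e. satisfies every ''$\le$'' and ''$\succeq$'' as ''$<$'' and ''$\succ$'', respectively. *)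

(* Defs.v *)
From HB Require Import structures.
From mathcomp Require Import all_boot all_order all_algebra.
From mathcomp Require Import sesquilinear.
From mathcomp Require Import boolp classical_sets reals ereal.
Set Implicit Arguments.
Unset Strict Implicit.
Unset Printing Implicit Defensive.
Import Order.TTheory GRing.Theory Num.Theory.
Local Open Scope classical_set_scope.
Local Open Scope ring_scope.

Definition psd_ge (R : realType) (p : nat) (A B : 'M[R]_p) : Prop :=
  [/\ A \is symmetricmx, B \is symmetricmx &
      forall v : 'cV[R]_p, 0 <= (v^T *m (A - B) *m v) 0 0].

Definition pd_gt (R : realType) (p : nat) (A B : 'M[R]_p) : Prop :=
  [/\ A \is symmetricmx, B \is symmetricmx &
      forall v : 'cV[R]_p, v != 0 -> 0 < (v^T *m (A - B) *m v) 0 0].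

Definition symoff (R : realType) (p : nat) (A : 'M[R]_p) : Prop :=
  A \is symmetricmx /\ forall i, A i i = 0.

(* The default value 0 is only reached when S has no positive semi-definite
   square root, that is, when S is not itself positive semi-definite. *)
Definition sqrtmx (R : realType) (p : nat) (S : 'M[R]_p) : 'M[R]_p :=
  xget 0 [set B | psd_ge B 0 /\ B *m B = S].

Definition symmx (R : realType) (p : nat) (A : 'M[R]_p) : 'M[R]_p :=
  2^-1 *: (A + A^T).

Definition offmx (R : realType) (p : nat) (A : 'M[R]_p) : 'M[R]_p :=
  \matrix_(i, j) (if i == j then 0 else A i j).

Definition l1off (R : realType) (p : nat) (A : 'M[R]_p) : R :=
  \sum_k \sum_(l | k != l) `|A k l|.

(* MathComp-Analysis equips matrices with the max norm, hence this definition. *)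
Definition frob (R : realType) (p : nat) (A : 'M[R]_p) : R :=
  Num.sqrt (\sum_i \sum_j A i j ^+ 2).

Definition mxinner (R : realType) (p : nat) (A B : 'M[R]_p) : R :=
  \tr (A^T *m B).

(* Times are shifted by one: t : 'I_T stands for the time t + 1, and
   t : 'I_T.-1 for the time t + 1 <= T - 1, at which now_t t and next_t t
   are the positions of the times t + 1 and t + 2 in 'I_T. *)
Definition now_t (T : nat) (t : 'I_T.-1) : 'I_T := widen_ord (leq_pred T) t.

Lemma next_t_subproof (T : nat) (t : 'I_T.-1) : (t.+1 < T)%N.
Proof. by rewrite -ltn_predRL. Qed.

Definition next_t (T : nat) (t : 'I_T.-1) : 'I_T := Ordinal (next_t_subproof t).

Definition incr (R : realType) (p T : nat) (Theta : 'I_T -> 'M[R]_p)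
    (t : 'I_T.-1) : 'M[R]_p :=
  Theta (next_t t) - Theta (now_t t).

Definition sqrtXX (R : realType) (p T : nat) (X : 'I_T -> 'cV[R]_p)
    (t : 'I_T) : 'M[R]_p :=
  sqrtmx (X t *m (X t)^T).

Definition primal_feasible (R : realType) (p T : nat) (eps : R)
    (Theta : 'I_T -> 'M[R]_p) : Prop :=
  forall t, psd_ge (Theta t) eps%:M.

Definition primal_obj (R : realType) (p T : nat) (X : 'I_T -> 'cV[R]_p)
    (lam1 lam2 : R) (Theta : 'I_T -> 'M[R]_p) : R :=
  \sum_(t < T) (\tr (2^-1 *: (Theta t *m Theta t *m (X t *m (X t)^T)))
          - \tr (Theta t))
  + lam1 * T%:R * \sum_(t < T) l1off (Theta t)
  + lam2 * T%:R * \sum_(t < T.-1) frob (incr Theta t).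

Definition primal_val (R : realType) (p T : nat) (X : 'I_T -> 'cV[R]_p)
    (eps lam1 lam2 : R) : \bar R :=
  ereal_inf [set (primal_obj X lam1 lam2 Theta)%:E
            | Theta in primal_feasible (T := T) eps].

Definition primal_optimal (R : realType) (p T : nat) (X : 'I_T -> 'cV[R]_p)
    (eps lam1 lam2 : R) (Theta : 'I_T -> 'M[R]_p) : Prop :=
  primal_feasible eps Theta /\
  forall Theta', primal_feasible eps Theta' ->
    primal_obj X lam1 lam2 Theta <= primal_obj X lam1 lam2 Theta'.

(* The dual is the Lagrangian dual of the primal problem rewritten with the
   auxiliary variables U_t = (X_t X_t^T)^(1/2) Theta_t,
   Upsilon_t = Theta_(t,off) and D_t = Theta_(t+1) - Theta_t, the constraints
   Theta_t >= eps I being kept in the objective as an indicator function. *)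

Record splitvar (R : realType) (p T : nat) := SplitVar {
  sTheta : 'I_T -> 'M[R]_p;
  sU : 'I_T -> 'M[R]_p;
  sUps : 'I_T -> 'M[R]_p;
  sD : 'I_T.-1 -> 'M[R]_p }.

Record dualvar (R : realType) (p T : nat) := DualVar {
  dW : 'I_T -> 'M[R]_p;
  dY : 'I_T -> 'M[R]_p;
  dZ : 'I_T.-1 -> 'M[R]_p }.

Definition split_domain (R : realType) (p T : nat) (s : splitvar R p T) : Prop :=
  [/\ forall t, sTheta s t \is symmetricmx,
      forall t, symoff (sUps s t) &
      forall t, sD s t \is symmetricmx].

Definition dual_domain (R : realType) (p T : nat) (y : dualvar R p T) : Prop :=
  (forall t, symoff (dY y t)) /\ (forall t, dZ y t \is symmetricmx).

Definition indicator_psd (R : realType) (p : nat) (eps : R) (A : 'M[R]_p) :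
    \bar R :=
  if `[< psd_ge A eps%:M >] then 0%E else +oo%E.

Definition split_obj (R : realType) (p T : nat) (eps lam1 lam2 : R)
    (s : splitvar R p T) : \bar R :=
  (\sum_(t < T) ((2^-1 * \tr ((sU s t)^T *m sU s t) - \tr (sTheta s t))%:E
           + indicator_psd eps (sTheta s t))
   + (lam1 * T%:R * \sum_(t < T) l1off (sUps s t))%:E
   + (lam2 * T%:R * \sum_(t < T.-1) frob (sD s t))%:E)%E.

Definition split_pairing (R : realType) (p T : nat) (X : 'I_T -> 'cV[R]_p)
    (s : splitvar R p T) (y : dualvar R p T) : R :=
  \sum_(t < T) mxinner (dW y t) (sU s t - sqrtXX X t *m sTheta s t)
  + \sum_(t < T) mxinner (dY y t) (offmx (sTheta s t) - sUps s t)
  + \sum_(t < T.-1) mxinner (dZ y t) (incr (sTheta s) t - sD s t).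

Definition lagrangian (R : realType) (p T : nat) (X : 'I_T -> 'cV[R]_p)
    (eps lam1 lam2 : R) (s : splitvar R p T) (y : dualvar R p T) : \bar R :=
  (split_obj eps lam1 lam2 s - (split_pairing X s y)%:E)%E.

Definition lagrange_dual (R : realType) (p T : nat) (X : 'I_T -> 'cV[R]_p)
    (eps lam1 lam2 : R) (y : dualvar R p T) : \bar R :=
  ereal_inf [set lagrangian X eps lam1 lam2 s y
            | s in split_domain (R := R) (p := p) (T := T)].

(* Here k is the time itself: the result is Z_k for 1 <= k <= T - 1, and the
   convention Z_0 = Z_T = 0 is built in. *)
Definition Zext (R : realType) (p T : nat) (Z : 'I_T.-1 -> 'M[R]_p) (k : nat) :
    'M[R]_p :=
  if k is j.+1 then oapp Z 0 (insub j : option 'I_T.-1) else 0.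

Definition dual_slack (R : realType) (p T : nat) (X : 'I_T -> 'cV[R]_p)
    (y : dualvar R p T) (t : 'I_T) : 'M[R]_p :=
  Zext (dZ y) t.+1 - Zext (dZ y) t - 1%:M
  + symmx (sqrtXX X t *m dW y t) - dY y t.

Definition dual_obj (R : realType) (p T : nat) (X : 'I_T -> 'cV[R]_p)
    (eps : R) (y : dualvar R p T) : R :=
  \sum_(t < T) - (2^-1 * \tr ((dW y t)^T *m dW y t))
  + eps * \sum_(t < T) \tr (Zext (dZ y) t.+1 - Zext (dZ y) t - 1%:M
                      + sqrtXX X t *m dW y t - dY y t).

Definition dual_feasible (R : realType) (p T : nat) (X : 'I_T -> 'cV[R]_p)
    (lam1 lam2 : R) (y : dualvar R p T) : Prop :=
  dual_domain y /\
  forall t : 'I_T,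
    [/\ psd_ge (dual_slack X y t) 0,
        frob (Zext (dZ y) t.+1) <= lam2 * T%:R &
        forall u v, u != v -> `|dY y t u v| <= lam1 * T%:R].

Definition dual_slater (R : realType) (p T : nat) (X : 'I_T -> 'cV[R]_p)
    (lam1 lam2 : R) (y : dualvar R p T) : Prop :=
  dual_feasible X lam1 lam2 y /\
  forall t : 'I_T,
    [/\ pd_gt (dual_slack X y t) 0,
        frob (Zext (dZ y) t.+1) < lam2 * T%:R &
        forall u v, u != v -> `|dY y t u v| < lam1 * T%:R].

Definition dual_val (R : realType) (p T : nat) (X : 'I_T -> 'cV[R]_p)
    (eps lam1 lam2 : R) : \bar R :=
  ereal_sup [set (dual_obj X eps y)%:E | y in dual_feasible X lam1 lam2].

(* Main.v *)
(* Both halves of the argument rest on one finite-dimensional Hahn-Banach lemma,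
   with no topology. A subgradient at 0 of the value of the split problem, as a
   function of perturbations of its (affine) constraints, is a multiplier at which
   the Lagrangian stays above the primal value; being bounded below there, the
   Lagrangian forces dual feasibility, and strong duality follows. If the dual has a
   Slater point, perturbing the slack matrices by small symmetric matrices keeps it
   feasible, so the dual value also has a subgradient at 0; that subgradient is,
   up to the shift by eps I, an optimal primal solution. *)
Require Import Defs.
From HB Require Import structures.
From mathcomp Require Import all_boot all_order all_algebra.
From mathcomp Require Import sesquilinear ring lra.
From mathcomp Require Import boolp classical_sets reals ereal.
Set Implicit Arguments.
Unset Strict Implicit.
Unset Printing Implicit Defensive.
Import Order.TTheory GRing.Theory Num.Theory.
Local Open Scope ring_scope.

(** The two uses of the separation lemma differ in how they meet its absorption hypothesis. In the
    split problem the auxiliary variables are free, so with every [Theta t] frozen at [eps I] any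
    perturbation of the constraints is realised: the multiplier exists for every choice of data. In
    the dual the perturbed slacks must stay positive semi-definite, and this is where strict
    definiteness enters, made quantitative by a coercivity constant. Values are handled through a
    relation [E u r] (some admissible point has perturbation [u] and excess cost at most [r]), so
    infima need be neither attained nor finite. Absorption is demanded in every matrix direction,
    whereas the constraints live in spaces of symmetric or zero-diagonal matrices; perturbations,
    and then multipliers, are therefore composed with the projections [symmx] and [offmx]. A
    subgradient of the dual value becomes a primal optimum because each primal cost is itself a
    value of the Lagrangian, taken at the explicit multipliers [dual_subgradient]. *)

(** * Affine and quadratic inequalities in one real variable *)

Lemma affine_slope_ge0 (R : realFieldType) (m c x : R) :
  (forall k, 0 <= k -> m <= c + k * x) -> 0 <= x.
Proof.
move=> H; rewrite leNgt; apply/negP => x0.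
have cm : m <= c by have := H 0 (lexx 0); rewrite mul0r addr0.
(* For this [k] the affine function takes the value [m - 1]. *)
have k0 : 0 <= (c - m + 1) / - x by apply: divr_ge0; lra.
have := H _ k0; rewrite invrN mulrN mulNr divfK ?lt_eqF //; lra.
Qed.

(** Evaluate at the minimiser [- b / c]; if [c = 0] and [b != 0], the chosen [s] gives the value
    [-1]. Both Cauchy-Schwarz inequalities below come from it. *)
Lemma quadratic_discr (R : realFieldType) (a b c : R) : 0 <= c ->
  (forall s, 0 <= a + 2 * b * s + c * s ^+ 2) -> b ^+ 2 <= a * c.
Proof.
move=> c_ge0 H; have [c0|cN0] := eqVneq c 0.
  have [->|bN0] := eqVneq b 0; first by rewrite c0 mulr0 expr0n.
  have := H (- (a + 1) / (2 * b)); rewrite c0 mul0r addr0 mulrC divfK; first lra.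
  by rewrite mulf_neq0 // pnatr_eq0.
have cp : 0 < c by rewrite lt_def cN0.
have := H (- b / c).
have -> : a + 2 * b * (- b / c) + c * (- b / c) ^+ 2 = (a * c - b ^+ 2) / c by field.
by rewrite pmulr_lge0 ?invr_gt0 // subr_ge0.
Qed.

(** * Finite-dimensional Hahn-Banach *)

(** A segment joining a point left of the vertical axis to one on its right crosses the axis at
    nonnegative height, so every slope [r' / x'] from the left is at most every slope [r / x] from
    the right. The supremum of the left slopes separates them. *)
Lemma supporting_slope (R : realType) (E : R -> R -> Prop) :
  (forall c x r x' r', 0 <= c <= 1 -> E x r -> E x' r' ->
     E (c * x + (1 - c) * x') (c * r + (1 - c) * r')) ->
  (forall r, E 0 r -> 0 <= r) ->
  (exists x r, 0 < x /\ E x r) -> (exists x r, x < 0 /\ E x r) ->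
  exists a, forall x r, E x r -> a * x <= r.
Proof.
move=> cvxE E0 [xp [rp [xp0 Ep]]] [xn [rn [xn0 En]]].
have key x r x' r' : 0 < x -> x' < 0 -> E x r -> E x' r' -> r' / x' <= r / x.
  move=> x0 x'0 Ex Ex'.
  have d0 : 0 < x - x' by lra.
  have d0' : x - x' != 0 by rewrite gt_eqF.
  (* The weight for which the convex combination of [x] and [x'] is [0]. *)
  have c01 : 0 <= - x' / (x - x') <= 1.
    by apply/andP; split; [apply: divr_ge0 | rewrite ler_pdivrMr // mul1r]; lra.
  have := cvxE _ _ _ _ _ c01 Ex Ex'.
  have -> : - x' / (x - x') * x + (1 - - x' / (x - x')) * x' = 0 by field.
  move/E0.
  have -> : - x' / (x - x') * r + (1 - - x' / (x - x')) * r' =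
            (r' * x - r * x') / (x - x') by field.
  rewrite pmulr_lge0 ?invr_gt0 // => h.
  by rewrite ler_pdivlMr // mulrAC ler_ndivrMr //; lra.
pose S : set R := fun a => exists x r, [/\ x < 0, E x r & a = r / x].
have Sne : has_sup S.
  split; first by exists (rn / xn), xn, rn.
  by exists (rp / xp) => a [x [r [x0 Ex ->]]]; apply: key.
exists (sup S) => x r Ex.
have [x0|x0|x0] := ltrgtP x 0; last by rewrite x0 mulr0; apply: E0; rewrite -x0.
  by rewrite -ler_ndivrMr //; apply: sup_upper_bound => //; exists x, r.
rewrite -ler_pdivlMr //; apply: ge_sup; first by case: Sne.
by move=> a [x' [r' [x'0 Ex' ->]]]; apply: key.
Qed.

(** The functional is extended one coordinate at a time, each extension being a choice of slope in
    the plane. The last hypothesis says that [0] is absorbing: it supplies points on both sides of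
    the axis for the new coordinate. *)
Lemma hahn_banach_finite (R : realType) (I : finType) (E : (I -> R) -> R -> Prop) :
  (forall c u r u' r', 0 <= c <= 1 -> E u r -> E u' r' ->
     E (fun i => c * u i + (1 - c) * u' i) (c * r + (1 - c) * r')) ->
  (forall r, E (fun=> 0) r -> 0 <= r) ->
  (forall u, exists s r, 0 < s /\ E (fun i => s * u i) r) ->
  exists a : I -> R, forall u r, E u r -> \sum_i a i * u i <= r.
Proof.
move=> cvxE E0 absE.
suff H (s : seq I) : uniq s -> exists a : I -> R, forall u r,
    (forall i, i \notin s -> u i = 0) -> E u r -> \sum_(i <- s) a i * u i <= r.
  have [a Ha] := H _ (enum_uniq I); exists a => u r Eur; rewrite -big_enum /=.
  by apply: Ha => // i; rewrite mem_enum.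
elim: s => [_|i s IH /= /andP[iNs us]].
  exists (fun=> 0) => u r u0 Eur; rewrite big_nil; apply: E0.
  by rewrite -(_ : u = fun=> 0) //; apply: funext => i; apply: u0.
have [a Ha] := IH us.
(* The epigraph over the enlarged subspace, lowered by the functional already found and projected to
   the coordinate [i]; over [x = 0] it is nonnegative by [Ha]. *)
pose E' x r' := exists u r, [/\ forall j, j \notin i :: s -> u j = 0, E u r,
  x = u i & r' = r - \sum_(j <- s) a j * u j].
have dir e : exists x r, 0 < x /\ E' (e * x) r.
  have [t [r [t0 Et]]] := absE (fun j => if j == i then e else 0).
  exists t; eexists; split=> //; eexists; exists r; split; [| exact: Et | | by []].
    by move=> j; rewrite inE negb_or => /andP[] /negbTE -> _; rewrite mulr0.
  by rewrite /= eqxx mulrC.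
have [| | | |b Hb] := @supporting_slope R E'.
- move=> c x r x' r' c01 [u [q [u0 Eu -> ->]]] [u' [q' [u0' Eu' -> ->]]].
  exists (fun i => c * u i + (1 - c) * u' i), (c * q + (1 - c) * q').
  split => //; first by move=> j js; rewrite u0 ?u0' // !mulr0 addr0.
    exact: cvxE.
  have -> : \sum_(j <- s) a j * (c * u j + (1 - c) * u' j) =
     c * (\sum_(j <- s) a j * u j) + (1 - c) * (\sum_(j <- s) a j * u' j).
    rewrite !mulr_sumr -big_split /=; apply: eq_bigr => j _; ring.
  ring.
- move=> _ [u [r [u0 Eu ui ->]]]; rewrite subr_ge0; apply: Ha => // j js.
  have [->//|ji] := eqVneq j i; apply: u0; rewrite inE negb_or ji; exact: js.
- by have [x [r [x0 Ex]]] := dir 1; exists x, r; rewrite mul1r in Ex.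
- have [x [r [x0 Ex]]] := dir (-1); exists (-1 * x), r; split => //; lra.
exists (fun j => if j == i then b else a j) => u r u0 Eu.
rewrite big_cons eqxx.
have -> : \sum_(j <- s) (if j == i then b else a j) * u j = \sum_(j <- s) a j * u j.
  apply: eq_big_seq => j js; case: eqP => // ji; by rewrite ji (negbTE iNs) in js.
by rewrite -lerBrDr; apply: Hb; exists u, r.
Qed.

(** * Inner product and semi-definite matrices *)

Lemma symmetricmxP (R : realType) (p : nat) (A : 'M[R]_p) :
  reflect (A^T = A) (A \is symmetricmx).
Proof.
by apply: (iffP (is_hermitianmxP _ _ _)); rewrite expr0 scale1r map_mx_id // => ->.
Qed.

Lemma mxinnerE (R : realType) (p : nat) (A B : 'M[R]_p) :
  mxinner A B = \sum_i \sum_j A i j * B i j.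
Proof.
rewrite /mxinner /mxtrace exchange_big; apply: eq_bigr => i _ /=.
by rewrite mxE; apply: eq_bigr => j _; rewrite mxE.
Qed.

Lemma mxinnerC (R : realType) (p : nat) (A B : 'M[R]_p) : mxinner A B = mxinner B A.
Proof. by rewrite /mxinner -mxtrace_tr trmx_mul trmxK. Qed.

Lemma mxinnerDr (R : realType) (p : nat) (A B C : 'M[R]_p) :
  mxinner A (B + C) = mxinner A B + mxinner A C.
Proof. by rewrite /mxinner mulmxDr mxtraceD. Qed.

Lemma mxinnerZr (R : realType) (p : nat) (A B : 'M[R]_p) (k : R) :
  mxinner A (k *: B) = k * mxinner A B.
Proof. by rewrite /mxinner -scalemxAr mxtraceZ. Qed.

Lemma mxinnerNr (R : realType) (p : nat) (A B : 'M[R]_p) :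
  mxinner A (- B) = - mxinner A B.
Proof. by rewrite -scaleN1r mxinnerZr mulN1r. Qed.

Lemma mxinnerBr (R : realType) (p : nat) (A B C : 'M[R]_p) :
  mxinner A (B - C) = mxinner A B - mxinner A C.
Proof. by rewrite mxinnerDr mxinnerNr. Qed.

Lemma mxinner0r (R : realType) (p : nat) (A : 'M[R]_p) : mxinner A 0 = 0.
Proof. by rewrite /mxinner mulmx0 mxtrace0. Qed.

Lemma mxinnerDl (R : realType) (p : nat) (A B C : 'M[R]_p) :
  mxinner (A + B) C = mxinner A C + mxinner B C.
Proof. by rewrite !(mxinnerC _ C) mxinnerDr. Qed.

Lemma mxinnerZl (R : realType) (p : nat) (A B : 'M[R]_p) (k : R) :
  mxinner (k *: A) B = k * mxinner A B.
Proof. by rewrite !(mxinnerC _ B) mxinnerZr. Qed.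

Lemma mxinnerNl (R : realType) (p : nat) (A B : 'M[R]_p) :
  mxinner (- A) B = - mxinner A B.
Proof. by rewrite !(mxinnerC _ B) mxinnerNr. Qed.

Lemma mxinnerBl (R : realType) (p : nat) (A B C : 'M[R]_p) :
  mxinner (A - B) C = mxinner A C - mxinner B C.
Proof. by rewrite mxinnerDl mxinnerNl. Qed.

Lemma mxinner0l (R : realType) (p : nat) (A : 'M[R]_p) : mxinner 0 A = 0.
Proof. by rewrite mxinnerC mxinner0r. Qed.

Lemma mxinner1l (R : realType) (p : nat) (A : 'M[R]_p) : mxinner 1%:M A = \tr A.
Proof. by rewrite /mxinner trmx1 mul1mx. Qed.

Lemma mxinnerTT (R : realType) (p : nat) (A B : 'M[R]_p) :
  mxinner A^T B^T = mxinner A B.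
Proof. by rewrite /mxinner -trmx_mul mxtrace_tr mxtrace_mulC. Qed.

Lemma mxinner_mulmxr (R : realType) (p : nat) (A B C : 'M[R]_p) :
  mxinner A (B *m C) = mxinner (B^T *m A) C.
Proof. by rewrite /mxinner trmx_mul trmxK mulmxA. Qed.

Lemma mxinner_symmxl (R : realType) (p : nat) (A B : 'M[R]_p) :
  B^T = B -> mxinner (symmx A) B = mxinner A B.
Proof.
move=> symB; rewrite /symmx mxinnerZl mxinnerDl -[in X in _ + X]symB mxinnerTT.
by field.
Qed.

Lemma trmx_symmx (R : realType) (p : nat) (A : 'M[R]_p) : (symmx A)^T = symmx A.
Proof. by rewrite /symmx linearZ linearD /= trmxK addrC. Qed.

Lemma symmx_id (R : realType) (p : nat) (A : 'M[R]_p) : A^T = A -> symmx A = A.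
Proof. by rewrite /symmx => ->; apply/matrixP => i j; rewrite !mxE; field. Qed.

Lemma mxinner_ge0 (R : realType) (p : nat) (A : 'M[R]_p) : 0 <= mxinner A A.
Proof.
by rewrite mxinnerE; do 2 (apply: sumr_ge0 => ? _); rewrite -expr2 sqr_ge0.
Qed.

Lemma mxinner_tr_cauchy_schwarz (R : realType) (p : nat) (A B : 'M[R]_p) :
  mxinner A B ^+ 2 <= mxinner A A * mxinner B B.
Proof.
apply: quadratic_discr => [|s]; first exact: mxinner_ge0.
have := mxinner_ge0 (A + s *: B).
by rewrite !(mxinnerDl, mxinnerDr, mxinnerZl, mxinnerZr) (mxinnerC B A); lra.
Qed.

Lemma frobE (R : realType) (p : nat) (A : 'M[R]_p) : frob A = Num.sqrt (mxinner A A).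
Proof. by rewrite mxinnerE. Qed.

Lemma frob_ge0 (R : realType) (p : nat) (A : 'M[R]_p) : 0 <= frob A.
Proof. exact: sqrtr_ge0. Qed.

Lemma frob_sqr (R : realType) (p : nat) (A : 'M[R]_p) : frob A ^+ 2 = mxinner A A.
Proof. by rewrite frobE sqr_sqrtr ?mxinner_ge0. Qed.

Lemma normr_mxinner_le (R : realType) (p : nat) (A B : 'M[R]_p) :
  `|mxinner A B| <= frob A * frob B.
Proof.
rewrite -(@ler_pXn2r _ 2) // ?nnegrE ?mulr_ge0 ?frob_ge0 //.
by rewrite exprMn !frob_sqr real_normK ?num_real // mxinner_tr_cauchy_schwarz.
Qed.

Lemma frob0 (R : realType) (p : nat) : frob (0 : 'M[R]_p) = 0.
Proof. by rewrite frobE mxinner0l sqrtr0. Qed.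

Lemma frobZ (R : realType) (p : nat) (k : R) (A : 'M[R]_p) :
  frob (k *: A) = `|k| * frob A.
Proof.
by rewrite !frobE mxinnerZl mxinnerZr mulrA -expr2 sqrtrM ?sqr_ge0 // sqrtr_sqr.
Qed.

Lemma frobD (R : realType) (p : nat) (A B : 'M[R]_p) :
  frob (A + B) <= frob A + frob B.
Proof.
rewrite -(@ler_pXn2r _ 2) // ?nnegrE ?addr_ge0 ?frob_ge0 //.
rewrite sqrrD !frob_sqr mxinnerDl !mxinnerDr (mxinnerC B A).
have := le_trans (ler_norm _) (normr_mxinner_le A B); lra.
Qed.

(** Quadratic forms become linear in the matrix, so that positivity statements can use the
    bilinearity of [mxinner]; in particular [mxinner 1%:M (v *m v^T)] is the squared Euclidean norm
    of [v]. *)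
Lemma qform_mxinner (R : realType) (p : nat) (A : 'M[R]_p) (u v : 'cV[R]_p) :
  (u^T *m A *m v) 0 0 = mxinner A (u *m v^T).
Proof.
rewrite /mxinner mulmxA mxtrace_mulC trace_mx11.
have -> : v^T *m (A^T *m u) = (u^T *m A *m v)^T by rewrite !trmx_mul trmxK.
by rewrite [RHS]mxE.
Qed.

Lemma psd_geP (R : realType) (p : nat) (A B : 'M[R]_p) : A^T = A -> B^T = B ->
  psd_ge A B <-> forall v : 'cV[R]_p, 0 <= mxinner (A - B) (v *m v^T).
Proof.
move=> symA symB; split=> [[_ _ H] v | H]; first by rewrite -qform_mxinner.
by split; [exact/symmetricmxP | exact/symmetricmxP | move=> v; rewrite qform_mxinner].
Qed.

Lemma psd_ge0P (R : realType) (p : nat) (A : 'M[R]_p) : A^T = A ->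
  psd_ge A 0 <-> forall v : 'cV[R]_p, 0 <= mxinner A (v *m v^T).
Proof. by move=> symA; rewrite psd_geP ?trmx0 // subr0. Qed.

Lemma psd_ge_sub0 (R : realType) (p : nat) (A B : 'M[R]_p) : B^T = B ->
  psd_ge A B <-> psd_ge (A - B) 0.
Proof.
move=> symB; split=> [[/symmetricmxP symA _ H] | [/symmetricmxP symAB _ H]].
  by apply/psd_ge0P => [|v]; rewrite ?linearB /= ?symA ?symB // -qform_mxinner.
have symA : A^T = A by rewrite -[A](subrK B) linearD /= symAB symB.
by apply/psd_geP => // v; rewrite -qform_mxinner -[A - B]subr0.
Qed.

Lemma mxinner_rank1C (R : realType) (p : nat) (A : 'M[R]_p) (u v : 'cV[R]_p) :
  A^T = A -> mxinner A (u *m v^T) = mxinner A (v *m u^T).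
Proof. by move=> symA; rewrite -mxinnerTT symA trmx_mul trmxK. Qed.

Lemma psd_cauchy_schwarz (R : realType) (p : nat) (A : 'M[R]_p) (u v : 'cV[R]_p) :
  psd_ge A 0 ->
  mxinner A (u *m v^T) ^+ 2 <= mxinner A (u *m u^T) * mxinner A (v *m v^T).
Proof.
move=> psdA; have [/symmetricmxP symA _ _] := psdA.
have A_ge0 := (psd_ge0P symA).1 psdA.
apply: quadratic_discr => // s; have := A_ge0 (u + s *: v).
rewrite linearD linearZ /= mulmxDl !mulmxDr -!scalemxAl -!scalemxAr.
by rewrite !(mxinnerDr, mxinnerZr) (mxinner_rank1C v u symA); lra.
Qed.

Lemma psd_rank1 (R : realType) (p : nat) (v : 'cV[R]_p) : psd_ge (v *m v^T) 0.
Proof.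
apply/psd_ge0P => [|w]; first by rewrite trmx_mul trmxK.
rewrite -qform_mxinner -mulmxA -mulmxA mulmxA mxE big_ord1.
have -> : v^T *m w = (w^T *m v)^T by rewrite trmx_mul trmxK.
by rewrite [_^T _ _]mxE -expr2 sqr_ge0.
Qed.

Lemma mxinner_delta (R : realType) (p : nat) (A : 'M[R]_p) (i j : 'I_p) :
  mxinner A (delta_mx i (0 : 'I_1) *m (delta_mx j 0)^T) = A i j.
Proof.
rewrite trmx_delta mul_delta_mx mxinnerE (bigD1 i) //= (bigD1 j) //=.
rewrite mxE !eqxx mulr1 !big1 ?addr0 // => [k ki|k kj].
  by rewrite big1 // => l _; rewrite mxE (negbTE ki) mulr0.
by rewrite mxE (negbTE kj) andbF mulr0.
Qed.

(* Subtracting the rank one matrix [(B e_i)(B e_i)^T / B_ii] from [B] keeps it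
   positive semi-definite by Cauchy-Schwarz, and clears its i-th diagonal entry. *)
Lemma psd_mxinner_ge0 (R : realType) (p : nat) (A B : 'M[R]_p) :
  psd_ge A 0 -> psd_ge B 0 -> 0 <= mxinner A B.
Proof.
move=> psdA; have [/symmetricmxP symA _ _] := psdA.
have A_ge0 := (psd_ge0P symA).1 psdA.
have [n] := ubnP #|[pred i | B i i != 0]|; elim: n B => // n IH B leBn psdB.
have [/symmetricmxP symB _ _] := psdB.
have B_ge0 := (psd_ge0P symB).1 psdB.
have CS i j : B i j ^+ 2 <= B i i * B j j.
  by rewrite -!mxinner_delta; exact: psd_cauchy_schwarz.
have Bii i : 0 <= B i i by rewrite -mxinner_delta.
case: (pickP [pred i | B i i != 0]) => [i /= Bi | B0]; last first.
  suff -> : B = 0 by rewrite mxinner0r.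
  apply/matrixP => i j; rewrite mxE; apply/eqP; rewrite -sqrf_eq0 eq_le sqr_ge0.
  by have /= := CS i j; have /= /negbFE/eqP -> := B0 i; rewrite mul0r => ->.
have Bi0 : 0 < B i i by rewrite lt_def Bi Bii.
pose e : 'cV[R]_p := delta_mx i 0; pose w := B *m e.
pose C := B - (B i i)^-1 *: (w *m w^T).
have symC : C^T = C by rewrite /C linearB linearZ /= trmx_mul trmxK symB.
have CE v : mxinner C (v *m v^T) =
    mxinner B (v *m v^T) - (B i i)^-1 * mxinner B (v *m e^T) ^+ 2.
  rewrite mxinnerBl mxinnerZl; congr (_ - _ * _).
  rewrite -!qform_mxinner -mulmxA -mulmxA mulmxA mxE big_ord1 expr2.
  have -> : w^T *m v = (v^T *m w)^T by rewrite [RHS]trmx_mul trmxK.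
  by rewrite [_^T _ _]mxE /w mulmxA.
have psdC : psd_ge C 0.
  apply/psd_ge0P => // v; rewrite CE subr_ge0 mulrC ler_pdivrMr //.
  rewrite -(mxinner_delta B i i); exact: psd_cauchy_schwarz.
have CiiE k : C k k = B k k - (B i i)^-1 * B k i ^+ 2.
  by rewrite -(mxinner_delta C) CE !mxinner_delta.
have -> : B = C + (B i i)^-1 *: (w *m w^T) by rewrite subrK.
rewrite mxinnerDr mxinnerZr; apply: addr_ge0; last first.
  by rewrite mulr_ge0 // ?invr_ge0.
rewrite ltnS in leBn; apply: IH => //; apply: leq_trans leBn; apply: proper_card.
(* The number of nonzero diagonal entries drops: where [B k k = 0], [CS] forces [B k i = 0], so the
   entry of [C] stays zero, while the i-th one is cleared. *)
apply/properP; split.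
  apply/fintype.subsetP => k; rewrite !inE; apply: contraNneq => Bk0; rewrite CiiE Bk0.
  have := CS k i; rewrite Bk0 mul0r le_eqVlt ltNge sqr_ge0 orbF => /eqP ->.
  by rewrite mulr0 subrr.
by exists i; rewrite !inE //= CiiE expr2 mulKf // subrr eqxx.
Qed.

Lemma mxinner_quad_le (R : realType) (p : nat) (A : 'M[R]_p) :
  exists2 C, 0 <= C & forall v : 'cV[R]_p,
    `|mxinner A (v *m v^T)| <= C * mxinner 1%:M (v *m v^T).
Proof.
exists (\sum_i \sum_j `|A i j|); first by do 2 (apply: sumr_ge0 => ? _).
move=> v; have vvE i j : (v *m v^T) i j = v i 0 * v j 0.
  by rewrite mxE big_ord1 mxE.
rewrite mxinner1l mxinnerE mulr_suml; apply: le_trans (ler_norm_sum _ _ _) _.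
apply: ler_sum => i _; rewrite mulr_suml; apply: le_trans (ler_norm_sum _ _ _) _.
apply: ler_sum => j _; rewrite normrM ler_wpM2l // vvE normrM.
have le_tr k : `|v k 0| ^+ 2 <= \tr (v *m v^T).
  rewrite real_normK ?num_real // /mxtrace (bigD1 k) //= vvE -expr2 lerDl.
  by apply: sumr_ge0 => l _; rewrite vvE -expr2 sqr_ge0.
have := le_tr i; have := le_tr j; have := sqr_ge0 (`|v i 0| - `|v j 0|); lra.
Qed.

Lemma norm2_gt0 (R : realType) (p : nat) (v : 'cV[R]_p) :
  v != 0 -> 0 < mxinner 1%:M (v *m v^T).
Proof.
move=> v0; rewrite lt_def -[X in (X != 0) && _]qform_mxinner mulmx1.
have [k vk] : exists k, v k 0 != 0.
  apply/existsP; apply: contraNT v0 => /existsPn H.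
  by apply/eqP/colP => k; rewrite mxE; apply/eqP; have := H k; rewrite negbK.
rewrite -qform_mxinner mulmx1 mxE.
have E i : v^T 0 i * v i 0 = v i 0 ^+ 2 by rewrite mxE expr2.
under eq_bigr do rewrite E.
rewrite psumr_eq0 => [|i _]; last exact: sqr_ge0.
rewrite sumr_ge0 ?andbT => [|i _]; last exact: sqr_ge0.
by apply/allPn; exists k; rewrite ?mem_index_enum // sqrf_eq0.
Qed.

(* [(v^T v)^2 = (v^T A (A^-1 v))^2 <= (v^T A v) (v^T A^-1 v)], and the last factor
   is bounded by a multiple of [v^T v]. *)
Lemma pd_gt_coercive (R : realType) (p : nat) (A : 'M[R]_p) : pd_gt A 0 ->
  exists2 c, 0 < c & forall v : 'cV[R]_p,
    c * mxinner 1%:M (v *m v^T) <= mxinner A (v *m v^T).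
Proof.
case=> /symmetricmxP symA _ pdA.
have A_gt0 (v : 'cV[R]_p) : v != 0 -> 0 < mxinner A (v *m v^T).
  by move=> /pdA; rewrite subr0 qform_mxinner.
have A_ge0 (v : 'cV[R]_p) : 0 <= mxinner A (v *m v^T).
  by have [->|/A_gt0/ltW//] := eqVneq v 0; rewrite mul0mx mxinner0r.
have unitA : A \in unitmx.
  rewrite -row_free_unit -kermx_eq0; apply/rowV0P => u /sub_kermxP uA.
  apply/eqP; rewrite -trmx_eq0; apply: contraTT isT => /A_gt0.
  by rewrite -qform_mxinner trmxK uA mul0mx mxE ltxx.
have [C C0 HC] := mxinner_quad_le (invmx A).
(* [C] is only known to be nonnegative, hence the [+ 1]. *)
exists (C + 1)^-1 => [|v]; first by rewrite invr_gt0; lra.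
have [->|v0] := eqVneq v 0; first by rewrite mul0mx !mxinner0r mulr0.
have := psd_cauchy_schwarz v (invmx A *m v) ((psd_ge0P symA).2 A_ge0).
have -> : mxinner A (v *m (invmx A *m v)^T) = mxinner 1%:M (v *m v^T).
  by rewrite -!qform_mxinner mulmxA mulmxK // mulmx1.
have -> : mxinner A (invmx A *m v *m (invmx A *m v)^T) = mxinner (invmx A) (v *m v^T).
  by rewrite -!qform_mxinner trmx_mul trmx_inv symA mulmxA mulmxKV.
have := le_trans (ler_norm _) (HC v); have := norm2_gt0 v0.
set n := mxinner 1%:M _; set a := mxinner A _; set b := mxinner _ _ => n0 bn CS.
have a0 : 0 <= a := A_ge0 v.
rewrite mulrC ler_pdivrMr; last lra.
rewrite -(ler_pM2r n0) -expr2; apply: le_trans CS _.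
have := ler_wpM2l a0 bn; have := mulr_ge0 a0 (ltW n0); lra.
Qed.

(** * The Lagrangian *)

(** [xget] returns a root as soon as one exists, and a rank one matrix has an explicit one: [x x^T]
    divided by the Euclidean norm of [x], or [0] if [x = 0]. *)
Lemma sqrtXXP (R : realType) (p T : nat) (X : 'I_T -> 'cV[R]_p) t :
  psd_ge (sqrtXX X t) 0 /\ sqrtXX X t *m sqrtXX X t = X t *m (X t)^T.
Proof.
rewrite /sqrtXX /sqrtmx; set x := X t.
apply: (@xgetPex _ 0 [set B | psd_ge B 0 /\ B *m B = x *m x^T]).
have [->|x0] := eqVneq x 0.
  exists 0; split; last by rewrite !mul0mx.
  by apply/psd_ge0P => [|v]; rewrite ?trmx0 // mxinner0l.
have n0 := norm2_gt0 x0; set n := mxinner _ _ in n0.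
exists ((Num.sqrt n)^-1 *: (x *m x^T)); split.
  apply/psd_ge0P => [|v]; first by rewrite linearZ /= trmx_mul trmxK.
  rewrite mxinnerZl mulr_ge0 ?invr_ge0 ?sqrtr_ge0 //.
  by apply: psd_mxinner_ge0; exact: psd_rank1.
rewrite -scalemxAl -scalemxAr scalerA mulmxA -(mulmxA x) [x^T *m x]mx11_scalar.
rewrite -[x^T]mulmx1 qform_mxinner -/n mulmx1 mul_mx_scalar -scalemxAl scalerA.
by rewrite -expr2 exprVn sqr_sqrtr ?(ltW n0) // mulVf ?scale1r // gt_eqF.
Qed.

Lemma trmx_sqrtXX (R : realType) (p T : nat) (X : 'I_T -> 'cV[R]_p) t :
  (sqrtXX X t)^T = sqrtXX X t.
Proof. by have [[/symmetricmxP]] := sqrtXXP X t. Qed.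

Lemma sumr_if_eq (V : nmodType) (W : zmodType) (I : finType) (F : I -> V -> W)
    (i : I) (x : V) : (forall j, F j 0 = 0) ->
  \sum_j F j (if j == i then x else 0) = F i x.
Proof.
move=> F0; rewrite (bigD1 i) //= eqxx big1 ?addr0 // => j /negbTE ->; exact: F0.
Qed.

(** * The off-diagonal norm and the dual norm bounds *)

Lemma l1offZ (R : realType) (p : nat) (k : R) (A : 'M[R]_p) :
  l1off (k *: A) = `|k| * l1off A.
Proof.
rewrite /l1off mulr_sumr; apply: eq_bigr => i _; rewrite mulr_sumr.
by apply: eq_bigr => j _; rewrite mxE normrM.
Qed.

Lemma l1offD (R : realType) (p : nat) (A B : 'M[R]_p) :
  l1off (A + B) <= l1off A + l1off B.
Proof.
rewrite /l1off -big_split; apply: ler_sum => i _; rewrite -big_split.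
by apply: ler_sum => j _; rewrite mxE ler_normD.
Qed.

Lemma l1off0 (R : realType) (p : nat) : l1off (0 : 'M[R]_p) = 0.
Proof. by rewrite -[0](scale0r 0) l1offZ normr0 mul0r. Qed.

Lemma l1off_delta (R : realType) (p : nat) (u v : 'I_p) : u != v ->
  l1off (delta_mx u v : 'M[R]_p) = 1.
Proof.
move=> uv; rewrite /l1off (bigD1 u) //= (bigD1 v) //= mxE !eqxx normr1.
rewrite !big1 ?addr0 // => [k ku|k /andP[_ kv]].
  by rewrite big1 // => l _; rewrite mxE (negbTE ku) normr0.
by rewrite mxE (negbTE kv) andbF normr0.
Qed.

Lemma l1off_offmx (R : realType) (p : nat) (A : 'M[R]_p) : l1off (offmx A) = l1off A.
Proof.
apply: eq_bigr => k _; apply: eq_bigr => l /negbTE kl; by rewrite mxE kl.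
Qed.

Lemma mxinner_zero_diag (R : realType) (p : nat) (A B : 'M[R]_p) :
  (forall i, A i i = 0) ->
  mxinner A B = \sum_k \sum_(l | k != l) A k l * B k l.
Proof.
move=> A0; rewrite mxinnerE; apply: eq_bigr => k _.
rewrite (bigD1 k) //= A0 mul0r add0r; apply: eq_bigl => l; by rewrite eq_sym.
Qed.

Lemma mxinner_offmx (R : realType) (p : nat) (A B : 'M[R]_p) :
  (forall i, A i i = 0) -> mxinner A (offmx B) = mxinner A B.
Proof.
move=> A0; rewrite !mxinner_zero_diag //; apply: eq_bigr => k _.
by apply: eq_bigr => l /negbTE kl; rewrite mxE kl.
Qed.

Lemma offmx_symoff (R : realType) (p : nat) (A : 'M[R]_p) :
  A^T = A -> symoff (offmx A).
Proof.
move=> symA; split=> [|i]; last by rewrite mxE eqxx.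
apply/symmetricmxP/matrixP => i j; rewrite !mxE eq_sym; case: eqP => // _.
by rewrite -{1}symA mxE.
Qed.

Lemma symoff_offmx (R : realType) (p : nat) (A : 'M[R]_p) : symoff A -> offmx A = A.
Proof. by case=> _ A0; apply/matrixP => i j; rewrite mxE; case: eqP => // ->. Qed.

(** Hölder's inequality between the entrywise [l1] and maximum norms, with the sign in which the
    pairing occurs in the Lagrangian. *)
Lemma l1off_dual_ge0 (R : realType) (p : nat) (L : R) (Y A : 'M[R]_p) :
  (forall i, Y i i = 0) -> (forall u v, u != v -> `|Y u v| <= L) ->
  0 <= L * l1off A + mxinner Y A.
Proof.
move=> Y0 YL; rewrite mxinner_zero_diag // mulr_sumr -big_split /=.
apply: sumr_ge0 => k _; rewrite mulr_sumr -big_split /=; apply: sumr_ge0 => l kl.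
have := ler_wpM2r (normr_ge0 (A k l)) (YL _ _ kl); rewrite -normrM.
by have := lerNnormlW (lexx `|Y k l * A k l|); lra.
Qed.

Lemma frob_dual_ge0 (R : realType) (p : nat) (L : R) (Z A : 'M[R]_p) :
  frob Z <= L -> 0 <= L * frob A + mxinner Z A.
Proof.
move=> ZL; have := ler_wpM2r (frob_ge0 A) ZL; have := normr_mxinner_le Z A.
by have := lerNnormlW (lexx `|mxinner Z A|); lra.
Qed.

(** The indicator is left out: it vanishes on feasible points, where all computations can then stay
    in [R]. *)
Definition real_split_obj (R : realType) (p T : nat) (lam1 lam2 : R)
    (s : splitvar R p T) : R :=
  \sum_(t < T) (2^-1 * \tr ((sU s t)^T *m sU s t) - \tr (sTheta s t))
  + lam1 * T%:R * \sum_(t < T) l1off (sUps s t)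
  + lam2 * T%:R * \sum_(t < T.-1) frob (sD s t).

Definition real_lagrangian (R : realType) (p T : nat) (X : 'I_T -> 'cV[R]_p)
    (lam1 lam2 : R) (s : splitvar R p T) (y : dualvar R p T) : R :=
  real_split_obj lam1 lam2 s - split_pairing X s y.

Lemma lagrangian_feasible (R : realType) (p T : nat) (X : 'I_T -> 'cV[R]_p)
    (eps lam1 lam2 : R) (s : splitvar R p T) (y : dualvar R p T) :
  primal_feasible eps (sTheta s) ->
  lagrangian X eps lam1 lam2 s y = (real_lagrangian X lam1 lam2 s y)%:E.
Proof.
move=> feas; rewrite /lagrangian /split_obj big_split /=.
rewrite [X in (_ + X + _ + _ + _)%E]big1 ?adde0 => [|t _]; last first.
  by rewrite /indicator_psd asboolT.
by rewrite sumEFin.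
Qed.

Lemma lagrangian_infeasible (R : realType) (p T : nat) (X : 'I_T -> 'cV[R]_p)
    (eps lam1 lam2 : R) (s : splitvar R p T) (y : dualvar R p T) :
  ~ primal_feasible eps (sTheta s) -> lagrangian X eps lam1 lam2 s y = +oo%E.
Proof.
move=> /existsNP[t infeas]; rewrite /lagrangian /split_obj.
rewrite [X in (X + _ + _ + _)%E](_ : _ = +oo%E) //.
apply/esum_eqyP; first by move=> i _; rewrite /indicator_psd; case: asboolP.
by exists t; split=> //; rewrite /indicator_psd asboolF.
Qed.

(** Abel summation; the boundary terms vanish because [Zext] is [0] at times [0] and [T]. This is
    the origin of the differences of consecutive multipliers in the slack. *)
Lemma sum_Zext_by_parts (R : realType) (p T : nat) (Z : 'I_T.-1 -> 'M[R]_p)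
    (Theta : 'I_T -> 'M[R]_p) :
  \sum_(t < T.-1) mxinner (Z t) (incr Theta t) =
  - \sum_(t < T) mxinner (Zext Z t.+1 - Zext Z t) (Theta t).
Proof.
case: T Z Theta => [|T] Z Theta; first by rewrite !big_ord0 oppr0.
rewrite -sumrN.
under [RHS]eq_bigr do rewrite mxinnerBl opprB.
rewrite sumrB big_ord_recl mxinner0l add0r [X in _ - X]big_ord_recr /=.
(* At the final time the index lies outside the range of [Z], so [Zext] takes its default value
   [0]. *)
rewrite insubF ?ltnn // mxinner0l addr0 -sumrB; apply: eq_bigr => t _ /=.
rewrite !(insubT (fun i => i < T)%N (ltn_ord t)) /= -mxinnerBr; congr mxinner.
  by congr Z; apply: val_inj.
by rewrite /incr; congr (Theta _ - Theta _); apply: val_inj.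
Qed.

(* The [symmx] in the slack is immaterial against a symmetric [sTheta s t]. *)
Lemma real_lagrangianE (R : realType) (p T : nat) (X : 'I_T -> 'cV[R]_p)
    (lam1 lam2 : R) (s : splitvar R p T) (y : dualvar R p T) :
  (forall t, (sTheta s t)^T = sTheta s t) -> dual_domain y ->
  real_lagrangian X lam1 lam2 s y =
    \sum_t (2^-1 * mxinner (sU s t) (sU s t) - mxinner (dW y t) (sU s t))
    + \sum_t mxinner (dual_slack X y t) (sTheta s t)
    + \sum_t (lam1 * T%:R * l1off (sUps s t) + mxinner (dY y t) (sUps s t))
    + \sum_t (lam2 * T%:R * frob (sD s t) + mxinner (dZ y t) (sD s t)).
Proof.
move=> symTh [Yoff _]; rewrite /real_lagrangian /real_split_obj /split_pairing.
have E1 t : mxinner (dW y t) (sU s t - sqrtXX X t *m sTheta s t) =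
    mxinner (dW y t) (sU s t) - mxinner (sqrtXX X t *m dW y t) (sTheta s t).
  by rewrite mxinnerBr [X in _ - X]mxinner_mulmxr trmx_sqrtXX.
have E2 t : mxinner (dY y t) (offmx (sTheta s t) - sUps s t) =
    mxinner (dY y t) (sTheta s t) - mxinner (dY y t) (sUps s t).
  by rewrite mxinnerBr mxinner_offmx //; case: (Yoff t).
have E4 t : mxinner (dual_slack X y t) (sTheta s t) =
    mxinner (Zext (dZ y) t.+1 - Zext (dZ y) t) (sTheta s t) - \tr (sTheta s t)
    + mxinner (sqrtXX X t *m dW y t) (sTheta s t) - mxinner (dY y t) (sTheta s t).
  by rewrite /dual_slack !(mxinnerBl, mxinnerDl, mxinnerNl) mxinner1l mxinner_symmxl.
under [X in _ - (X + _ + _)]eq_bigr do rewrite E1.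
under [X in _ - (_ + X + _)]eq_bigr do rewrite E2.
under [X in _ - (_ + _ + X)]eq_bigr do rewrite mxinnerBr.
under [X in _ = _ + X + _ + _]eq_bigr do rewrite E4.
rewrite !(sumrB, big_split) /= -!mulr_sumr sum_Zext_by_parts.
rewrite /mxinner; ring.
Qed.

(** A matrix and its symmetric part have the same trace, so the [eps] term is the pairing of each
    slack with [eps I], the least point of the cone over which [Theta t] ranges. *)
Lemma dual_objE (R : realType) (p T : nat) (X : 'I_T -> 'cV[R]_p) (eps : R)
    (y : dualvar R p T) :
  dual_obj X eps y = \sum_t (- (2^-1 * mxinner (dW y t) (dW y t)))
    + \sum_t mxinner (dual_slack X y t) eps%:M.
Proof.
rewrite /dual_obj mulr_sumr; congr (_ + _); apply: eq_bigr => t _.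
rewrite -(scalemx1 _ eps) mxinnerZr mxinnerC mxinner1l /dual_slack; congr (_ * _).
rewrite !(mxtraceD, raddfN) /=; congr (_ + _ - _).
by rewrite /symmx mxtraceZ mxtraceD mxtrace_tr; field.
Qed.

Lemma hahn_banach_mx (R : realType) (p : nat) (J : finType)
    (E : (J -> 'M[R]_p) -> R -> Prop) :
  (forall c U r U' r', 0 <= c <= 1 -> E U r -> E U' r' ->
     E (fun j => c *: U j + (1 - c) *: U' j) (c * r + (1 - c) * r')) ->
  (forall r, E (fun=> 0) r -> 0 <= r) ->
  (forall U, exists s r, 0 < s /\ E (fun j => s *: U j) r) ->
  exists G : J -> 'M[R]_p, forall U r, E U r -> \sum_j mxinner (G j) (U j) <= r.
Proof.
move=> cvxE E0 absE.
pose toM (u : J * ('I_p * 'I_p) -> R) j : 'M[R]_p := \matrix_(k, l) u (j, (k, l)).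
have [||u|a Ha] := @hahn_banach_finite R (J * ('I_p * 'I_p))%type (fun u => E (toM u)).
- move=> c u r u' r' c01 Eu Eu'; have := cvxE _ _ _ _ _ c01 Eu Eu'.
  by congr E; apply: funext => j; apply/matrixP => k l; rewrite !mxE.
- move=> r Er; apply: E0; rewrite (_ : (fun=> 0) = toM (fun=> 0)) //.
  by apply: funext => j; apply/matrixP => k l; rewrite !mxE.
- have [s [r [s0 Es]]] := absE (toM u); exists s, r; split => //.
  rewrite (_ : toM _ = fun j => s *: toM u j) //.
  by apply: funext => j; apply/matrixP => k l; rewrite !mxE.
exists (toM a) => U r EU.
have -> : \sum_j mxinner (toM a j) (U j) = \sum_i a i * U i.1 i.2.1 i.2.2.
  under eq_bigr => j _ do rewrite mxinnerE pair_big /=.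
  by rewrite pair_big /=; apply: eq_bigr => -[j [k l]] _; rewrite mxE.
apply: Ha; rewrite (_ : toM _ = U) //.
by apply: funext => j; apply/matrixP => k l; rewrite !mxE.
Qed.

Lemma trmx_Zext (R : realType) (p T : nat) (Z : 'I_T.-1 -> 'M[R]_p) k :
  (forall t, Z t \is symmetricmx) -> (Zext Z k)^T = Zext Z k.
Proof.
move=> symZ; case: k => [|k]; rewrite /= ?trmx0 //.
by case: insubP => [t _ _|_] /=; [exact/symmetricmxP | rewrite trmx0].
Qed.

Lemma trmx_dual_slack (R : realType) (p T : nat) (X : 'I_T -> 'cV[R]_p)
    (y : dualvar R p T) t : dual_domain y -> (dual_slack X y t)^T = dual_slack X y t.
Proof.
case=> [Yoff symZ]; have [/symmetricmxP symY _] := Yoff t.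
rewrite /dual_slack !(linearB, linearD) /= (trmx_Zext t.+1 symZ) trmx_Zext //.
by rewrite trmx1 trmx_symmx symY.
Qed.

Lemma primal_feasible_eps (R : realType) (p T : nat) (eps : R)
    (P : 'I_T -> 'M[R]_p) : (forall t, psd_ge (P t) 0) ->
  primal_feasible eps (fun t => eps%:M + P t).
Proof.
by move=> psdP t; apply/psd_ge_sub0; rewrite ?tr_scalar_mx // addrC addKr.
Qed.

Lemma trmx_primal_feasible (R : realType) (p T : nat) (eps : R)
  (Theta : 'I_T -> 'M[R]_p) t :
  primal_feasible eps Theta -> (Theta t)^T = Theta t.
Proof. by case/(_ t) => /symmetricmxP. Qed.

Lemma psd0 (R : realType) (p : nat) : psd_ge (0 : 'M[R]_p) 0.
Proof. by apply/psd_ge0P => [|v]; rewrite ?trmx0 // mxinner0l. Qed.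

Lemma psdZ (R : realType) (p : nat) (k : R) (A : 'M[R]_p) :
  0 <= k -> psd_ge A 0 -> psd_ge (k *: A) 0.
Proof.
move=> k0 psdA; have [/symmetricmxP symA _ _] := psdA.
apply/psd_ge0P => [|v]; first by rewrite linearZ /= symA.
by rewrite mxinnerZl mulr_ge0 //; exact: (psd_ge0P symA).1.
Qed.

Lemma psdD (R : realType) (p : nat) (A B : 'M[R]_p) :
  psd_ge A 0 -> psd_ge B 0 -> psd_ge (A + B) 0.
Proof.
move=> psdA psdB; have [/symmetricmxP symA _ _] := psdA.
have [/symmetricmxP symB _ _] := psdB.
apply/psd_ge0P => [|v]; first by rewrite linearD /= symA symB.
by rewrite mxinnerDl addr_ge0 //; [exact: (psd_ge0P symA).1 | exact: (psd_ge0P symB).1].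
Qed.

Lemma symoff0 (R : realType) (p : nat) : symoff (0 : 'M[R]_p).
Proof. by split=> [|i]; rewrite ?mxE //; apply/symmetricmxP; rewrite trmx0. Qed.

Lemma symoffZ (R : realType) (p : nat) (k : R) (A : 'M[R]_p) :
  symoff A -> symoff (k *: A).
Proof.
case=> /symmetricmxP symA A0; split=> [|i]; last by rewrite mxE A0 mulr0.
by apply/symmetricmxP; rewrite linearZ /= symA.
Qed.

Lemma symoffD (R : realType) (p : nat) (A B : 'M[R]_p) :
  symoff A -> symoff B -> symoff (A + B).
Proof.
case=> /symmetricmxP symA A0 [/symmetricmxP symB B0].
split=> [|i]; last by rewrite mxE A0 B0 addr0.
by apply/symmetricmxP; rewrite linearD /= symA symB.
Qed.

(** The four groups of [real_lagrangianE] are bounded separately: by completing the square in [sU],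
    by pairing each slack with the semi-definite matrix [Theta t - eps I], and by the two dual norm
    bounds. *)
Lemma dual_obj_le_lagrangian (R : realType) (p T : nat) (X : 'I_T -> 'cV[R]_p)
    (eps lam1 lam2 : R) (s : splitvar R p T) (y : dualvar R p T) :
  dual_feasible X lam1 lam2 y -> primal_feasible eps (sTheta s) ->
  dual_obj X eps y <= real_lagrangian X lam1 lam2 s y.
Proof.
move=> [dom feas] pfeas; have [Yoff symZ] := dom.
rewrite real_lagrangianE // => [|t]; last exact: trmx_primal_feasible pfeas.
rewrite dual_objE -[X in X <= _]addr0 -[X in X <= _]addr0.
apply: lerD; last first.
  apply: sumr_ge0 => t _; apply: frob_dual_ge0.
  by have [_] := feas (now_t t); rewrite /= (valK t).
apply: lerD; last first.
  apply: sumr_ge0 => t _; apply: l1off_dual_ge0; first by have [] := Yoff t.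
  by have [] := feas t.
apply: lerD; apply: ler_sum => t _.
  have := mxinner_ge0 (sU s t - dW y t).
  by rewrite mxinnerBl !mxinnerBr (mxinnerC (sU s t) (dW y t)); lra.
rewrite -subr_ge0 -mxinnerBr; apply: psd_mxinner_ge0; first by have [] := feas t.
exact: (psd_ge_sub0 _ (tr_scalar_mx _ _)).1.
Qed.

(* Along the ray [(eps I + k P, W, k Ups, k D)] the Lagrangian is affine in [k]. *)
Lemma bounded_lagrangian_slope (R : realType) (p T : nat) (X : 'I_T -> 'cV[R]_p)
    (eps lam1 lam2 m : R) (y : dualvar R p T) (P Ups : 'I_T -> 'M[R]_p)
    (D : 'I_T.-1 -> 'M[R]_p) :
  dual_domain y ->
  (forall s, split_domain s -> primal_feasible eps (sTheta s) ->
     m <= real_lagrangian X lam1 lam2 s y) ->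
  (forall t, psd_ge (P t) 0) -> (forall t, symoff (Ups t)) ->
  (forall t, (D t)^T = D t) ->
  0 <= \sum_t mxinner (dual_slack X y t) (P t)
       + \sum_t (lam1 * T%:R * l1off (Ups t) + mxinner (dY y t) (Ups t))
       + \sum_t (lam2 * T%:R * frob (D t) + mxinner (dZ y t) (D t)).
Proof.
move=> dom bnd psdP Upsoff symD.
apply: (@affine_slope_ge0 _ m (dual_obj X eps y)) => k k0.
pose s := SplitVar (fun t => eps%:M + k *: P t) (dW y) (fun t => k *: Ups t)
            (fun t => k *: D t).
have sfeas : primal_feasible eps (sTheta s).
  by apply: primal_feasible_eps => t; exact: psdZ.
have symTh t := trmx_primal_feasible t sfeas.
have sdom : split_domain s.
  split=> t; [exact/symmetricmxP/symTh | exact: symoffZ |].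
  by apply/symmetricmxP; rewrite linearZ /= symD.
have halfB (x : R) : 2^-1 * x - x = - (2^-1 * x) by field.
apply: le_trans (bnd _ sdom sfeas) _; rewrite real_lagrangianE // dual_objE /=.
under [X in _ + X + _ + _ <= _]eq_bigr do rewrite mxinnerDr mxinnerZr.
under [X in _ + _ + X + _ <= _]eq_bigr do
  rewrite l1offZ mxinnerZr (ger0_norm k0) mulrCA -mulrDr.
under [X in _ + _ + _ + X <= _]eq_bigr do
  rewrite frobZ mxinnerZr (ger0_norm k0) mulrCA -mulrDr.
under [X in X + _ + _ + _ <= _]eq_bigr do rewrite halfB.
rewrite big_split /= -!mulr_sumr; lra.
Qed.

(** Each dual constraint is read off from one direction in which the Lagrangian must not decrease,
    concentrated at a single time. *)
Lemma bounded_lagrangian_feasible (R : realType) (p T : nat) (X : 'I_T -> 'cV[R]_p)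
    (eps lam1 lam2 m : R) (y : dualvar R p T) :
  0 <= lam1 -> 0 <= lam2 -> dual_domain y ->
  (forall s, split_domain s -> primal_feasible eps (sTheta s) ->
     m <= real_lagrangian X lam1 lam2 s y) ->
  dual_feasible X lam1 lam2 y.
Proof.
move=> lam1_0 lam2_0 dom bnd; have [Yoff symZ] := dom.
have slope := bounded_lagrangian_slope dom bnd.
have D00 (t : 'I_T.-1) : (0 : 'M[R]_p)^T = 0 by rewrite trmx0.
have S2 : \sum_t (lam1 * T%:R * l1off (0 : 'M[R]_p) + mxinner (dY y t) 0) = 0.
  by rewrite big1 // => t _; rewrite l1off0 mxinner0r mulr0 addr0.
have S3 : \sum_t (lam2 * T%:R * frob (0 : 'M[R]_p) + mxinner (dZ y t) 0) = 0.
  by rewrite big1 // => t _; rewrite frob0 mxinner0r mulr0 addr0.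
have S1 : \sum_t mxinner (dual_slack X y t) 0 = 0.
  by rewrite big1 // => t _; rewrite mxinner0r.
split=> // t; split.
- apply/psd_ge0P => [|v]; first exact: trmx_dual_slack.
  have := slope (fun j => if j == t then v *m v^T else 0) (fun=> 0) (fun=> 0).
  rewrite S2 S3 !addr0 (sumr_if_eq (F := fun j => mxinner (dual_slack X y j))).
    apply=> // [j|j]; last exact: symoff0.
    by case: eqP => _; [exact: psd_rank1 | exact: psd0].
  by move=> j; rewrite mxinner0r.
- rewrite /=; case: insubP => [j _ _|_] /=; last first.
    by rewrite frob0 mulr_ge0 // ler0n.
  (* The direction [- dZ y j] is the equality case of Cauchy-Schwarz; the bound follows after
     division by [frob (dZ y j)] when this is nonzero. *)
  have := slope (fun=> 0) (fun=> 0) (fun i => if i == j then - dZ y j else 0).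
  rewrite S1 S2 !add0r (sumr_if_eq (F := fun i A => lam2 * T%:R * frob A
    + mxinner (dZ y i) A)); last by move=> i; rewrite frob0 mxinner0r mulr0 addr0.
  rewrite -scaleN1r frobZ normrN1 mul1r mxinnerZr mulN1r -frob_sqr => /= H.
  have {H} : 0 <= lam2 * T%:R * frob (dZ y j) - frob (dZ y j) ^+ 2.
    apply: H => [i|i|i]; [exact: psd0 | exact: symoff0 |].
    by case: eqP => _; rewrite ?trmx0 // linearZ /= (symmetricmxP _ _).
  have [->|Zn0] := eqVneq (frob (dZ y j)) 0; first by rewrite mulr_ge0 ?ler0n.
  by rewrite expr2 -mulrBl pmulr_lge0 ?subr_ge0 // lt_def Zn0 frob_ge0.
(* Directions for [sUps] must be symmetric, so the entries [(u, v)] and [(v, u)] are tested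
   together; the pairing and the bound on the norm both carry a factor [2]. *)
move=> u v uv; pose B : 'M[R]_p := delta_mx u v + delta_mx v u.
have Boff : symoff B.
  split=> [|i]; first by apply/symmetricmxP; rewrite linearD /= !trmx_delta addrC.
  rewrite !mxE; have [->|_] := eqVneq i u; last by rewrite andbF add0r.
  by rewrite (negbTE uv) addr0.
have BY : mxinner (dY y t) B = 2 * dY y t u v.
  have [/symmetricmxP symY _] := Yoff t.
  have Ed i j : delta_mx i j = delta_mx i (0 : 'I_1) *m (delta_mx j 0)^T :> 'M[R]_p.
    by rewrite trmx_delta mul_delta_mx.
  by rewrite mxinnerDr !Ed !mxinner_delta -{2}symY mxE mulr_natl mulr2n.
have B2 : l1off B <= 2.
  by apply: le_trans (l1offD _ _) _; rewrite !l1off_delta // eq_sym.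
have := slope (fun=> 0)
  (fun i => if i == t then - Num.sg (dY y t u v) *: B else 0) (fun=> 0).
rewrite S1 S3 add0r addr0 (sumr_if_eq (F := fun i A => lam1 * T%:R * l1off A
    + mxinner (dY y i) A)); last by move=> i; rewrite l1off0 mxinner0r mulr0 addr0.
rewrite l1offZ mxinnerZr BY normrN => H.
have {H} := H (fun=> @psd0 R p) _ _.
have LT : 0 <= lam1 * T%:R by rewrite mulr_ge0 // ler0n.
have sg1 : `|Num.sg (dY y t u v)| * l1off B <= 2.
  by rewrite normr_sg; case: (_ != 0); rewrite ?mul1r ?mul0r.
have -> : - Num.sg (dY y t u v) * (2 * dY y t u v) = - (2 * `|dY y t u v|).
  by rewrite normrEsg; ring.
move=> H; have := ler_wpM2l LT sg1.
have {H} : 0 <= lam1 * T%:R * (`|Num.sg (dY y t u v)| * l1off B) - 2 * `|dY y t u v|.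
  apply: H => j; last by rewrite trmx0.
  by case: eqP => _; [exact: symoffZ | exact: symoff0].
lra.
Qed.

(** * Strong duality *)

Lemma symmx_comb (R : realType) (p : nat) (a b : R) (A B : 'M[R]_p) :
  symmx (a *: A + b *: B) = a *: symmx A + b *: symmx B.
Proof. by apply/matrixP => i j; rewrite !mxE; ring. Qed.

Lemma offmx_comb (R : realType) (p : nat) (a b : R) (A B : 'M[R]_p) :
  offmx (a *: A + b *: B) = a *: offmx A + b *: offmx B.
Proof. by apply/matrixP => i j; rewrite !mxE; case: eqP => _ //; ring. Qed.

Lemma mxinner_mulmx_sqrtXX (R : realType) (p T : nat) (X : 'I_T -> 'cV[R]_p)
    (A : 'M[R]_p) t : A^T = A ->
  mxinner (sqrtXX X t *m A) (sqrtXX X t *m A) = \tr (A *m A *m (X t *m (X t)^T)).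
Proof.
move=> symA; rewrite mxinner_mulmxr trmx_sqrtXX mulmxA (sqrtXXP X t).2.
rewrite /mxinner !trmx_mul trmxK symA mxtrace_mulC mulmxA.
by rewrite -!mulmxA.
Qed.

Lemma primal_obj_split (R : realType) (p T : nat) (X : 'I_T -> 'cV[R]_p)
    (lam1 lam2 : R) (s : splitvar R p T) :
  (forall t, (sTheta s t)^T = sTheta s t) ->
  (forall t, sU s t = sqrtXX X t *m sTheta s t) ->
  (forall t, sUps s t = offmx (sTheta s t)) ->
  (forall t, sD s t = incr (sTheta s) t) ->
  real_split_obj lam1 lam2 s = primal_obj X lam1 lam2 (sTheta s).
Proof.
move=> symTh UE UpsE DE; rewrite /real_split_obj /primal_obj.
congr (_ + _ * _ + _ * _); apply: eq_bigr => t _.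
- rewrite mxtraceZ -[\tr (_^T *m _)]/(mxinner _ _) UE.
  by rewrite mxinner_mulmx_sqrtXX.
- by rewrite UpsE l1off_offmx.
- by rewrite DE.
Qed.

Lemma split_pairing_eq0 (R : realType) (p T : nat) (X : 'I_T -> 'cV[R]_p)
    (s : splitvar R p T) (y : dualvar R p T) :
  (forall t, sU s t = sqrtXX X t *m sTheta s t) ->
  (forall t, sUps s t = offmx (sTheta s t)) ->
  (forall t, sD s t = incr (sTheta s) t) ->
  split_pairing X s y = 0.
Proof.
move=> UE UpsE DE; rewrite /split_pairing !big1 ?addr0 // => t _.
- by rewrite DE subrr mxinner0r.
- by rewrite UpsE subrr mxinner0r.
- by rewrite UE subrr mxinner0r.
Qed.

(** At the split point built from [Theta] all constraint residuals vanish, so the Lagrangian there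
    is the primal cost. *)
Lemma weak_duality (R : realType) (p T : nat) (X : 'I_T -> 'cV[R]_p)
    (eps lam1 lam2 : R) (y : dualvar R p T) (Theta : 'I_T -> 'M[R]_p) :
  dual_feasible X lam1 lam2 y -> primal_feasible eps Theta ->
  dual_obj X eps y <= primal_obj X lam1 lam2 Theta.
Proof.
move=> feas pfeas.
pose s := SplitVar Theta (fun t => sqrtXX X t *m Theta t)
  (fun t => offmx (Theta t)) (incr Theta).
have := @dual_obj_le_lagrangian _ _ _ X eps lam1 lam2 s y feas pfeas.
rewrite /real_lagrangian (@split_pairing_eq0 _ _ _ X) // subr0.
by rewrite (@primal_obj_split _ _ _ X) // => t; exact: trmx_primal_feasible pfeas.
Qed.

Lemma psd_ge_convex (R : realType) (p : nat) (c : R) (A B C : 'M[R]_p) :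
  0 <= c <= 1 -> psd_ge A C -> psd_ge B C ->
  psd_ge (c *: A + (1 - c) *: B) C.
Proof.
move=> /andP[c0 c1] psdA psdB; have [_ /symmetricmxP symC _] := psdA.
apply/psd_ge_sub0 => //.
have -> : c *: A + (1 - c) *: B - C = c *: (A - C) + (1 - c) *: (B - C).
  by apply/matrixP => i j; rewrite !mxE; ring.
by apply: psdD; apply: psdZ; rewrite ?subr_ge0 //; exact: (psd_ge_sub0 _ symC).1.
Qed.

Lemma half_mxinner_convex (R : realType) (p : nat) (c : R) (A B : 'M[R]_p) :
  0 <= c <= 1 ->
  2^-1 * mxinner (c *: A + (1 - c) *: B) (c *: A + (1 - c) *: B)
  <= c * (2^-1 * mxinner A A) + (1 - c) * (2^-1 * mxinner B B).
Proof.
move=> /andP[c0 c1]; have c1' : 0 <= 1 - c by rewrite subr_ge0.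
have := mulr_ge0 (mulr_ge0 c0 c1') (mxinner_ge0 (A - B)).
rewrite !(mxinnerDl, mxinnerDr, mxinnerZl, mxinnerZr, mxinnerNl, mxinnerNr).
rewrite (mxinnerC B A); lra.
Qed.

Lemma real_split_obj_convex (R : realType) (p T : nat) (lam1 lam2 c : R)
    (s s' : splitvar R p T) : 0 <= lam1 -> 0 <= lam2 -> 0 <= c <= 1 ->
  real_split_obj lam1 lam2
    (SplitVar (fun t => c *: sTheta s t + (1 - c) *: sTheta s' t)
       (fun t => c *: sU s t + (1 - c) *: sU s' t)
       (fun t => c *: sUps s t + (1 - c) *: sUps s' t)
       (fun t => c *: sD s t + (1 - c) *: sD s' t)) <=
  c * real_split_obj lam1 lam2 s + (1 - c) * real_split_obj lam1 lam2 s'.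
Proof.
move=> lam1_0 lam2_0 c01; have /andP[c0 c1] := c01.
have c1' : 0 <= 1 - c by rewrite subr_ge0.
have T0 : 0 <= T%:R :> R := ler0n _ _.
pose q (s : splitvar R p T) :=
  \sum_(t < T) (2^-1 * mxinner (sU s t) (sU s t) - \tr (sTheta s t)).
pose l (s : splitvar R p T) := \sum_(t < T) l1off (sUps s t).
pose f (s : splitvar R p T) := \sum_(t < T.-1) frob (sD s t).
set s'' := SplitVar _ _ _ _.
have qle : q s'' <= c * q s + (1 - c) * q s'.
  rewrite /q !mulr_sumr -big_split; apply: ler_sum => t _ /=.
  rewrite mxtraceD !mxtraceZ.
  by have := half_mxinner_convex (sU s t) (sU s' t) c01; lra.
have lle : l s'' <= c * l s + (1 - c) * l s'.
  rewrite /l !mulr_sumr -big_split; apply: ler_sum => t _ /=.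
  by apply: le_trans (l1offD _ _) _; rewrite !l1offZ !ger0_norm.
have fle : f s'' <= c * f s + (1 - c) * f s'.
  rewrite /f !mulr_sumr -big_split; apply: ler_sum => t _ /=.
  by apply: le_trans (frobD _ _) _; rewrite !frobZ !ger0_norm.
have objE s0 : real_split_obj lam1 lam2 s0 =
    q s0 + lam1 * T%:R * l s0 + lam2 * T%:R * f s0 by [].
rewrite !objE.
have := ler_wpM2l (mulr_ge0 lam1_0 T0) lle.
have := ler_wpM2l (mulr_ge0 lam2_0 T0) fle.
move: (lam1 * _) (lam2 * _) (q _) (l _) (f _) (q s) (l s) (f s) (q s') (l s') (f s') qle.
by move=> L1 L2 *; lra.
Qed.

(** For a dual feasible [y], this point minimises each group of [real_lagrangianE] separately, so
    the infimum defining [lagrange_dual] is attained at it. *)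
Definition dual_argmin (R : realType) (p T : nat) (eps : R) (y : dualvar R p T) :
    splitvar R p T :=
  SplitVar (fun=> eps%:M) (dW y) (fun=> 0) (fun=> 0).

Lemma psd_ge_refl (R : realType) (p : nat) (k : R) : psd_ge (k%:M : 'M[R]_p) k%:M.
Proof.
by apply/psd_geP => [||v]; rewrite ?tr_scalar_mx // subrr mxinner0l.
Qed.

Lemma dual_argmin_domain (R : realType) (p T : nat) (eps : R) (y : dualvar R p T) :
  split_domain (dual_argmin eps y).
Proof.
split=> t /=; [apply/symmetricmxP | exact: symoff0 | apply/symmetricmxP].
  by rewrite tr_scalar_mx.
by rewrite trmx0.
Qed.

Lemma dual_argmin_feasible (R : realType) (p T : nat) (eps : R) (y : dualvar R p T) :
  primal_feasible eps (sTheta (dual_argmin eps y)).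
Proof. by move=> t; exact: psd_ge_refl. Qed.

Lemma real_lagrangian_argmin (R : realType) (p T : nat) (X : 'I_T -> 'cV[R]_p)
    (eps lam1 lam2 : R) (y : dualvar R p T) : dual_domain y ->
  real_lagrangian X lam1 lam2 (dual_argmin eps y) y = dual_obj X eps y.
Proof.
move=> dom; rewrite real_lagrangianE // => [|t]; last by rewrite tr_scalar_mx.
rewrite dual_objE /= [X in _ + X + _]big1 => [|t _]; last first.
  by rewrite l1off0 mxinner0r mulr0 addr0.
rewrite [X in _ + _ + X]big1 => [|t _]; last first.
  by rewrite frob0 mxinner0r mulr0 addr0.
by rewrite !addr0; congr (_ + _); apply: eq_bigr => t _; field.
Qed.

(* A subgradient at [0] of the value of the split problem as a function of
   perturbations of its equality constraints is a dual optimum. *)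
Lemma strong_duality (R : realType) (p T : nat) (X : 'I_T -> 'cV[R]_p)
    (eps lam1 lam2 m : R) : 0 <= lam1 -> 0 <= lam2 ->
  (forall Theta, primal_feasible eps Theta -> m <= primal_obj X lam1 lam2 Theta) ->
  exists2 y, dual_feasible X lam1 lam2 y & m <= dual_obj X eps y.
Proof.
move=> lam1_0 lam2_0 bnd.
pose J := ('I_T + 'I_T + 'I_T.-1)%type.
(* [U] ranges over arbitrary matrices; only its symmetric, and where relevant off-diagonal, part
   perturbs the last two families of constraints. *)
pose res (s : splitvar R p T) (U : J -> 'M[R]_p) := [/\
  forall t, U (inl (inl t)) = sU s t - sqrtXX X t *m sTheta s t,
  forall t, offmx (symmx (U (inl (inr t)))) = offmx (sTheta s t) - sUps s t &
  forall t, symmx (U (inr t)) = incr (sTheta s) t - sD s t].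
pose E U r := exists s, [/\ split_domain s, primal_feasible eps (sTheta s), res s U &
  real_split_obj lam1 lam2 s - m <= r].
have [||U|G HG] := @hahn_banach_mx R p J E.
- move=> c U r U' r' c01 [s [[symTh offUps symD] feas [r1 r2 r3] le_r]].
  move=> [s' [[symTh' offUps' symD'] feas' [r1' r2' r3'] le_r']].
  exists (SplitVar (fun t => c *: sTheta s t + (1 - c) *: sTheta s' t)
       (fun t => c *: sU s t + (1 - c) *: sU s' t)
       (fun t => c *: sUps s t + (1 - c) *: sUps s' t)
       (fun t => c *: sD s t + (1 - c) *: sD s' t)).
  have feas'' : primal_feasible eps (fun t => c *: sTheta s t + (1 - c) *: sTheta s' t).
    by move=> t; exact: psd_ge_convex.
  split=> //.
  + split=> /= t; first exact/symmetricmxP/(trmx_primal_feasible _ feas'').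
      by apply: symoffD; exact: symoffZ.
    apply/symmetricmxP; rewrite linearD !linearZ /=.
    by rewrite (symmetricmxP _ _) // (symmetricmxP _ _).
  + split=> /= t.
    * by rewrite r1 r1' mulmxDr -!scalemxAr; apply/matrixP => i j; rewrite !mxE; ring.
    * rewrite symmx_comb !offmx_comb r2 r2'.
      by apply/matrixP => i j; rewrite !mxE; ring.
    * by rewrite symmx_comb r3 r3'; apply/matrixP => i j; rewrite !mxE; ring.
  + have /andP[c0 c1] := c01.
    have := real_split_obj_convex s s' lam1_0 lam2_0 c01.
    have := ler_wpM2l c0 le_r; have := ler_wpM2l (_ : 0 <= 1 - c) le_r'.
    rewrite subr_ge0 => /(_ c1); lra.
- move=> r [s [_ feas [r1 r2 r3] le_r]]; apply: le_trans le_r; rewrite subr_ge0.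
  have s0 : symmx (0 : 'M[R]_p) = 0 by rewrite /symmx trmx0 addr0 scaler0.
  have o0 : offmx (0 : 'M[R]_p) = 0.
    by apply/matrixP => i j; rewrite !mxE; case: eqP.
  rewrite (@primal_obj_split _ _ _ X); first exact: bnd.
  + by move=> t; exact: trmx_primal_feasible feas.
  + by move=> t; apply/eqP; rewrite -subr_eq0 -r1.
  + by move=> t; apply/esym/eqP; rewrite -subr_eq0 -r2 s0 o0.
  + by move=> t; apply/esym/eqP; rewrite -subr_eq0 -r3 s0.
(* Absorption: [sU], [sUps] and [sD] take up the whole perturbation while [Theta] stays at [eps I],
   so the scaling factor can be [1]. *)
- pose s := SplitVar (fun t : 'I_T => (eps%:M : 'M[R]_p))
    (fun t => U (inl (inl t)) + sqrtXX X t *m eps%:M)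
    (fun t => offmx eps%:M - offmx (symmx (U (inl (inr t)))))
    (fun t : 'I_T.-1 => incr (fun _ : 'I_T => (eps%:M : 'M[R]_p)) t - symmx (U (inr t))).
  exists 1, (real_split_obj lam1 lam2 s - m); split=> //; exists s; split=> //.
  + split=> t /=; first by apply/symmetricmxP; rewrite tr_scalar_mx.
      rewrite -scaleN1r; apply: symoffD; last apply: symoffZ.
        by apply: offmx_symoff; rewrite tr_scalar_mx.
      by apply: offmx_symoff; rewrite trmx_symmx.
    by apply/symmetricmxP; rewrite /incr subrr sub0r linearN /= trmx_symmx.
  + by move=> t /=; apply/psd_ge_sub0; rewrite ?tr_scalar_mx // subrr; exact: psd0.
  + by split=> t /=; rewrite scale1r; [rewrite addrK | rewrite subKr | rewrite subKr].
(* The projections are self-adjoint and fix the residuals of split points, so projecting the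
   multipliers puts them in [dual_domain] without changing the pairing. *)
pose y := DualVar (fun t => G (inl (inl t))) (fun t => offmx (symmx (G (inl (inr t)))))
  (fun t => symmx (G (inr t))).
have dom : dual_domain y.
  split=> t /=; last by apply/symmetricmxP; rewrite trmx_symmx.
  by apply: offmx_symoff; rewrite trmx_symmx.
have Lbnd s : split_domain s -> primal_feasible eps (sTheta s) ->
    m <= real_lagrangian X lam1 lam2 s y.
  move=> sdom feas; have [symTh Upsoff symD] := sdom.
  pose U (k : J) := match k with
    | inl (inl t) => sU s t - sqrtXX X t *m sTheta s t
    | inl (inr t) => offmx (sTheta s t) - sUps s t
    | inr t => incr (sTheta s) t - sD s t end.
  have symTht t : (sTheta s t)^T = sTheta s t by exact/symmetricmxP.
  have off2 t : symoff (offmx (sTheta s t) - sUps s t).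
    by rewrite -scaleN1r; apply: symoffD; [exact: offmx_symoff | exact: symoffZ].
  have sym2 t : (offmx (sTheta s t) - sUps s t)^T = offmx (sTheta s t) - sUps s t.
    by have [/symmetricmxP] := off2 t.
  have sym3 t : (incr (sTheta s) t - sD s t)^T = incr (sTheta s) t - sD s t.
    by rewrite /incr !linearB /= !symTht (symmetricmxP _ _).
  have /HG : E U (real_split_obj lam1 lam2 s - m).
    exists s; split=> //; split=> t //=; last exact: symmx_id.
    by rewrite symmx_id // symoff_offmx.
  rewrite /real_lagrangian !big_sumType /= => H.
  rewrite (_ : split_pairing X s y = \sum_t mxinner (G (inl (inl t))) (U (inl (inl t)))
    + \sum_t mxinner (G (inl (inr t))) (U (inl (inr t)))
    + \sum_t mxinner (G (inr t)) (U (inr t))) /=; first by move: H => /=; lra.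
  congr (_ + _ + _); apply: eq_bigr => t _ /=; last by rewrite mxinner_symmxl.
  rewrite [LHS]mxinnerC [RHS]mxinnerC mxinner_offmx; last by have [] := off2 t.
  by rewrite mxinnerC mxinner_symmxl // mxinnerC.
have yfeas := bounded_lagrangian_feasible lam1_0 lam2_0 dom Lbnd.
exists y => //.
rewrite -(real_lagrangian_argmin X eps lam1 lam2 dom); apply: Lbnd.
  exact: dual_argmin_domain.
exact: dual_argmin_feasible.
Qed.

Lemma lagrange_dual_feasible (R : realType) (p T : nat) (X : 'I_T -> 'cV[R]_p)
    (eps lam1 lam2 : R) (y : dualvar R p T) : dual_feasible X lam1 lam2 y ->
  lagrange_dual X eps lam1 lam2 y = (dual_obj X eps y)%:E.
Proof.
move=> feas; have [dom _] := feas; apply/eqP; rewrite eq_le; apply/andP; split.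
  apply: ereal_inf_lbound; exists (dual_argmin eps y); first exact: dual_argmin_domain.
  rewrite lagrangian_feasible; last exact: dual_argmin_feasible.
  by rewrite real_lagrangian_argmin.
apply/ereal_infP => _ [s _ <-].
have [pfeas|pinfeas] := pselect (primal_feasible eps (sTheta s)).
  by rewrite lagrangian_feasible // lee_fin dual_obj_le_lagrangian.
by rewrite lagrangian_infeasible // leey.
Qed.

(** By contraposition: a value other than [-oo] provides a real lower bound for the Lagrangian,
    which forces feasibility. *)
Lemma lagrange_dual_infeasible (R : realType) (p T : nat) (X : 'I_T -> 'cV[R]_p)
    (eps lam1 lam2 : R) (y : dualvar R p T) :
  0 <= lam1 -> 0 <= lam2 -> dual_domain y -> ~ dual_feasible X lam1 lam2 y ->
  lagrange_dual X eps lam1 lam2 y = -oo%E.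
Proof.
move=> lam1_0 lam2_0 dom infeas; apply: contra_notP infeas => infN.
have [m Hm] : exists m : R, (m%:E <= lagrange_dual X eps lam1 lam2 y)%E.
  by case: (lagrange_dual _ _ _ _ _) infN => [r _| _|//];
    [exists r | exists 0; exact: leey].
apply: (bounded_lagrangian_feasible (m := m) (eps := eps)) => // s sdom sfeas.
rewrite -lee_fin -(@lagrangian_feasible _ _ _ _ eps) //; apply: le_trans Hm _.
by apply: ereal_inf_lbound; exists s.
Qed.

Lemma primal_dual_val (R : realType) (p T : nat) (X : 'I_T -> 'cV[R]_p)
    (eps lam1 lam2 : R) : 0 <= lam1 -> 0 <= lam2 ->
  primal_val X eps lam1 lam2 = dual_val X eps lam1 lam2.
Proof.
move=> lam1_0 lam2_0; apply/eqP; rewrite eq_le; apply/andP; split; last first.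
  apply/ereal_supP => _ [y feas <-]; apply/ereal_infP => _ [Theta pfeas <-].
  by rewrite lee_fin weak_duality.
case E : (primal_val X eps lam1 lam2) => [m| |]; last by rewrite leNye.
  have [Theta pfeas|y feas le_m] := @strong_duality _ _ _ X eps lam1 lam2 m lam1_0 lam2_0.
    by rewrite -lee_fin -E; apply: ereal_inf_lbound; exists Theta.
  apply: (@le_trans _ _ (dual_obj X eps y)%:E); first by rewrite lee_fin.
  by apply: ereal_sup_ubound; exists y.
(* The value [+oo] is excluded because the constant family [eps I] is feasible. *)
have : (primal_val X eps lam1 lam2 <= (primal_obj X lam1 lam2 (fun=> eps%:M))%:E)%E.
  by apply: ereal_inf_lbound; exists (fun=> eps%:M) => // t; exact: psd_ge_refl.
by rewrite E.
Qed.

(** * Attainment under the Slater condition *)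

Lemma Zext_comb (R : realType) (p T : nat) (a b : R) (Z Z' : 'I_T.-1 -> 'M[R]_p) k :
  Zext (fun t => a *: Z t + b *: Z' t) k = a *: Zext Z k + b *: Zext Z' k.
Proof.
case: k => [|k] /=; first by rewrite !scaler0 addr0.
by case: insubP => [t _ _|_] //=; rewrite !scaler0 addr0.
Qed.

Definition dual_comb (R : realType) (p T : nat) (c : R) (y y' : dualvar R p T) :
    dualvar R p T :=
  DualVar (fun t => c *: dW y t + (1 - c) *: dW y' t)
    (fun t => c *: dY y t + (1 - c) *: dY y' t)
    (fun t => c *: dZ y t + (1 - c) *: dZ y' t).

Lemma dual_slack_comb (R : realType) (p T : nat) (X : 'I_T -> 'cV[R]_p) (c : R)
    (y y' : dualvar R p T) t :
  dual_slack X (dual_comb c y y') t =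
  c *: dual_slack X y t + (1 - c) *: dual_slack X y' t.
Proof.
rewrite /dual_slack !Zext_comb mulmxDr -!scalemxAr symmx_comb.
by apply/matrixP => i j; rewrite !mxE; ring.
Qed.

Lemma dual_obj_concave (R : realType) (p T : nat) (X : 'I_T -> 'cV[R]_p) (eps c : R)
    (y y' : dualvar R p T) : 0 <= c <= 1 ->
  c * dual_obj X eps y + (1 - c) * dual_obj X eps y' <=
  dual_obj X eps (dual_comb c y y').
Proof.
move=> c01; rewrite !dual_objE !mulrDr !mulr_sumr addrACA.
apply: lerD; rewrite -big_split; apply: ler_sum => t _ /=.
  by have := half_mxinner_convex (dW y t) (dW y' t) c01; lra.
by rewrite dual_slack_comb [X in _ <= X]mxinnerDl !mxinnerZl.
Qed.

(** The dual constraints that are kept exact when the slacks are perturbed. *)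
Definition dual_box (R : realType) (p T : nat) (lam1 lam2 : R) (y : dualvar R p T) :
    Prop :=
  forall t : 'I_T, frob (Zext (dZ y) t.+1) <= lam2 * T%:R /\
    forall u v, u != v -> `|dY y t u v| <= lam1 * T%:R.

Lemma dual_comb_box (R : realType) (p T : nat) (lam1 lam2 c : R)
    (y y' : dualvar R p T) : 0 <= c <= 1 ->
  dual_box lam1 lam2 y -> dual_box lam1 lam2 y' ->
  dual_box lam1 lam2 (dual_comb c y y').
Proof.
move=> /andP[c0 c1] boxy boxy' t; have [Zy Yy] := boxy t; have [Zy' Yy'] := boxy' t.
have c1' : 0 <= 1 - c by rewrite subr_ge0.
have comb (L a b : R) : a <= L -> b <= L -> c * a + (1 - c) * b <= L.
  by move=> aL bL; have := ler_wpM2l c0 aL; have := ler_wpM2l c1' bL; lra.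
split=> [|u v uv].
  rewrite Zext_comb; apply: le_trans (frobD _ _) _; rewrite !frobZ !ger0_norm //.
  exact: comb.
rewrite /= !mxE; apply: le_trans (ler_normD _ _) _.
rewrite !normrM (ger0_norm c0) (ger0_norm c1').
by apply: comb; [exact: Yy | exact: Yy'].
Qed.

Lemma dual_comb_domain (R : realType) (p T : nat) (c : R) (y y' : dualvar R p T) :
  dual_domain y -> dual_domain y' -> dual_domain (dual_comb c y y').
Proof.
move=> [Yoff symZ] [Yoff' symZ']; split=> t /=; first by apply: symoffD; exact: symoffZ.
apply/symmetricmxP; rewrite linearD !linearZ /=.
by rewrite (symmetricmxP _ (symZ t)) (symmetricmxP _ (symZ' t)).
Qed.

(** Coercivity of [A t] with constant [c t] dominates a form bounded by [C t] once [s * C t <= c t].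
    Taking the inverse of one plus the sum of all [C t / c t] achieves this for every [t] at
    once. *)
Lemma pd_perturb (R : realType) (p T : nat) (A P : 'I_T -> 'M[R]_p) :
  (forall t, pd_gt (A t) 0) ->
  exists2 s : R, 0 < s & forall t, psd_ge (A t + s *: symmx (P t)) 0.
Proof.
move=> pdA.
have /choice[c Hc] t : exists c : R, 0 < c /\ forall v : 'cV[R]_p,
    c * mxinner 1%:M (v *m v^T) <= mxinner (A t) (v *m v^T).
  by have [c c0 H] := pd_gt_coercive (pdA t); exists c.
have /choice[C HC] t : exists C : R, 0 <= C /\ forall v : 'cV[R]_p,
    `|mxinner (symmx (P t)) (v *m v^T)| <= C * mxinner 1%:M (v *m v^T).
  by have [C C0 H] := mxinner_quad_le (symmx (P t)); exists C.
have q0 t : 0 <= C t / c t by rewrite divr_ge0 ?(HC t).1 // ltW ?(Hc t).1.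
pose D := 1 + \sum_t C t / c t.
have D0 : 0 < D by apply: ltr_wpDr => //; exact: sumr_ge0.
exists D^-1 => [|t]; first by rewrite invr_gt0.
have [c0 Ac] := Hc t; have [C0 PC] := HC t.
have [/symmetricmxP symA _ _] := pdA t.
apply/psd_ge0P => [|v]; first by rewrite linearD linearZ /= symA trmx_symmx.
rewrite mxinnerDl mxinnerZl.
have n0 : 0 <= mxinner 1%:M (v *m v^T).
  by have [->|/norm2_gt0/ltW//] := eqVneq v 0; rewrite mul0mx mxinner0r.
have sC : D^-1 * C t <= c t.
  rewrite mulrC ler_pdivrMr // mulrC -ler_pdivrMr // /D (bigD1 t) //=.
  have : 0 <= \sum_(i < T | i != t) C i / c i by apply: sumr_ge0.
  lra.
have Di : 0 <= D^-1 by rewrite invr_ge0 ltW.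
have := ler_wpM2r n0 sC; have := ler_wpM2l Di (PC v); have := Ac v.
have := ler_wpM2l Di (lerNnormlW (lexx `|mxinner (symmx (P t)) (v *m v^T)|)).
move: (D^-1) (mxinner _ _) (mxinner _ _) (mxinner _ _) => d a b n.
lra.
Qed.

(** The multipliers at which the inequalities for the quadratic and norm terms in weak duality
    become equalities at [Theta]; the minus signs compensate the plus signs of the pairings in
    [real_lagrangianE]. If [incr Theta t = 0], the multiplier is [0]. *)
Definition dual_subgradient (R : realType) (p T : nat) (X : 'I_T -> 'cV[R]_p)
    (lam1 lam2 : R) (Theta : 'I_T -> 'M[R]_p) : dualvar R p T :=
  DualVar (fun t => sqrtXX X t *m Theta t)
    (fun t => \matrix_(i, j)
       (if i == j then 0 else - (lam1 * T%:R) * Num.sg (Theta t i j)))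
    (fun t => - (lam2 * T%:R / frob (incr Theta t)) *: incr Theta t).

Lemma dual_subgradient_domain (R : realType) (p T : nat) (X : 'I_T -> 'cV[R]_p)
    (lam1 lam2 : R) (Theta : 'I_T -> 'M[R]_p) : (forall t, (Theta t)^T = Theta t) ->
  dual_domain (dual_subgradient X lam1 lam2 Theta).
Proof.
move=> symTh; split=> t /=.
  split=> [|i]; last by rewrite mxE eqxx.
  apply/symmetricmxP/matrixP => i j; rewrite !mxE eq_sym; case: eqP => // _.
  by rewrite -{1}symTh mxE.
by apply/symmetricmxP; rewrite linearZ /= /incr linearB /= !symTh.
Qed.

Lemma dual_subgradient_box (R : realType) (p T : nat) (X : 'I_T -> 'cV[R]_p)
    (lam1 lam2 : R) (Theta : 'I_T -> 'M[R]_p) : 0 <= lam1 -> 0 <= lam2 ->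
  dual_box lam1 lam2 (dual_subgradient X lam1 lam2 Theta).
Proof.
move=> lam1_0 lam2_0 t.
have L1 : 0 <= lam1 * T%:R by rewrite mulr_ge0 // ler0n.
have L2 : 0 <= lam2 * T%:R by rewrite mulr_ge0 // ler0n.
split=> [|u v uv] /=.
  case: insubP => [j _ _|_] /=; last by rewrite frob0.
  rewrite frobZ normrN ger0_norm; last by rewrite divr_ge0 ?frob_ge0.
  have [->|F0] := eqVneq (frob (incr Theta j)) 0; first by rewrite mulr0.
  by rewrite divfK.
rewrite mxE (negbTE uv) normrM normrN (ger0_norm L1) normr_sg.
by case: (_ != 0); rewrite ?mulr1 ?mulr0.
Qed.

(** The Lagrangian at the split point of [Theta] is the primal cost, and its norm terms cancel for
    this [y]. Hence the cost at [eps I + M] is a value of the Lagrangian of the dual, with [M] as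
    multiplier of the slack constraints. *)
Lemma primal_obj_subgradient (R : realType) (p T : nat) (X : 'I_T -> 'cV[R]_p)
    (eps lam1 lam2 : R) (M : 'I_T -> 'M[R]_p) : (forall t, (M t)^T = M t) ->
  let Theta := fun t => eps%:M + M t in
  let y := dual_subgradient X lam1 lam2 Theta in
  primal_obj X lam1 lam2 Theta =
  dual_obj X eps y + \sum_t mxinner (dual_slack X y t) (M t).
Proof.
move=> symM Theta y.
have symTh t : (Theta t)^T = Theta t by rewrite linearD /= tr_scalar_mx symM.
pose s := SplitVar Theta (fun t => sqrtXX X t *m Theta t)
  (fun t => offmx (Theta t)) (incr Theta).
have := @real_lagrangianE _ _ _ X lam1 lam2 s y symTh
  (dual_subgradient_domain _ _ _ symTh).
rewrite /real_lagrangian (@split_pairing_eq0 _ _ _ X) // subr0.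
rewrite (@primal_obj_split _ _ _ X) // => -> /=.
rewrite [X in _ + X + _]big1 => [|t _]; last first.
  rewrite mxinner_zero_diag /l1off => [|i]; last by rewrite mxE eqxx.
  rewrite mulr_sumr -big_split big1 // => k _.
  rewrite mulr_sumr -big_split big1 // => l /negbTE kl /=.
  by rewrite !mxE kl normrEsg; ring.
rewrite [X in _ + _ + X]big1 => [|t _]; last first.
  rewrite mxinnerZl -frob_sqr; have [->|F0] := eqVneq (frob (incr Theta t)) 0.
    by rewrite expr0n !mulr0 addr0.
  by field.
rewrite !addr0 dual_objE -addrA; congr (_ + _).
  by apply: eq_bigr => t _; field.
by rewrite -big_split; apply: eq_bigr => t _; rewrite mxinnerDr.
Qed.

(* Dualising the dual: a subgradient at [0] of the dual value as a function of
   perturbations of the slack matrices, shifted by [eps I], is a primal optimum. *)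
Lemma slater_primal_optimal (R : realType) (p T : nat) (X : 'I_T -> 'cV[R]_p)
    (eps lam1 lam2 : R) (y0 : dualvar R p T) :
  0 <= lam1 -> 0 <= lam2 -> dual_slater X lam1 lam2 y0 ->
  exists Theta, primal_optimal X eps lam1 lam2 Theta.
Proof.
move=> lam1_0 lam2_0 [feas0 slater0]; have [dom0 _] := feas0.
have box0 : dual_box lam1 lam2 y0.
  by move=> t; have [_ feas0t] := feas0; have [] := feas0t t.
pose vals :=
  [set primal_obj X lam1 lam2 Theta | Theta in primal_feasible (T := T) eps]%classic.
have vals0 : (vals !=set0)%classic.
  exists (primal_obj X lam1 lam2 (fun=> eps%:M)), (fun=> eps%:M) => // t.
  exact: psd_ge_refl.
have lb y : dual_feasible X lam1 lam2 y -> lbound vals (dual_obj X eps y).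
  by move=> feas _ [Theta pfeas <-]; exact: weak_duality.
(* A genuine infimum: [vals] contains the cost of [eps I] and is bounded below by the dual cost of
   [y0]. *)
pose v := inf vals.
have le_v y : dual_feasible X lam1 lam2 y -> dual_obj X eps y <= v.
  by move=> /lb; exact: lb_le_inf.
have v_le Theta : primal_feasible eps Theta -> v <= primal_obj X lam1 lam2 Theta.
  move=> pfeas; apply: ge_inf; last by exists Theta.
  by exists (dual_obj X eps y0); exact: lb.
(* [Q] is the perturbed slack. At [P = 0] the point [y] is dual feasible, and weak duality gives
   [0 <= r]. *)
pose E P r := exists y Q, [/\ dual_domain y, dual_box lam1 lam2 y,
  forall t, psd_ge (Q t) 0, forall t : 'I_T, symmx (P t) = Q t - dual_slack X y t &
  v - dual_obj X eps y <= r].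
have [||P|G HG] := @hahn_banach_mx R p 'I_T E.
- move=> c P r P' r' c01 [y [Q [dom box psdQ PE le_r]]].
  move=> [y' [Q' [dom' box' psdQ' PE' le_r']]].
  exists (dual_comb c y y'), (fun t => c *: Q t + (1 - c) *: Q' t); split=> [||t|t|].
  + exact: dual_comb_domain.
  + exact: dual_comb_box.
  + exact: psd_ge_convex.
  + rewrite symmx_comb PE PE' dual_slack_comb.
    by apply/matrixP => i j; rewrite !mxE; ring.
  + have := dual_obj_concave X eps y y' c01; have /andP[c0 c1] := c01.
    have c1' : 0 <= 1 - c by rewrite subr_ge0.
    by have := ler_wpM2l c0 le_r; have := ler_wpM2l c1' le_r'; lra.
- move=> r [y [Q [dom box psdQ PE le_r]]]; apply: le_trans le_r.
  rewrite subr_ge0; apply: le_v; split=> // t; have [? ?] := box t; split=> //.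
  suff <- : Q t = dual_slack X y t by [].
  by apply/eqP; rewrite -subr_eq0 -PE /symmx trmx0 addr0 scaler0.
(* Absorption: with [y0] fixed, its positive definite slacks tolerate a small multiple of any
   direction. *)
- have [|s s0 psdQ] := @pd_perturb _ _ _ (dual_slack X y0) P.
    by move=> t; have [] := slater0 t.
  exists s, (v - dual_obj X eps y0); split=> //.
  exists y0, (fun t => dual_slack X y0 t + s *: symmx (P t)); split=> // t.
  rewrite addrC addKr; apply/matrixP => i j; rewrite !mxE; ring.
pose M t := - symmx (G t).
have symM t : (M t)^T = M t by rewrite linearN /= trmx_symmx.
have HM y (Q : 'I_T -> 'M[R]_p) : dual_domain y -> dual_box lam1 lam2 y ->
    (forall t, psd_ge (Q t) 0) ->
    dual_obj X eps y + \sum_t mxinner (dual_slack X y t) (M t)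
    <= v + \sum_t mxinner (M t) (Q t).
  move=> dom box psdQ; pose P t := Q t - dual_slack X y t.
  have symP t : (P t)^T = P t.
    by have [/symmetricmxP symQ _ _] := psdQ t; rewrite linearB /= symQ trmx_dual_slack.
  have /HG : E P (v - dual_obj X eps y).
    by exists y, Q; split=> // t; rewrite symmx_id.
  have -> : \sum_t mxinner (G t) (P t) =
      \sum_t mxinner (dual_slack X y t) (M t) - \sum_t mxinner (M t) (Q t).
    rewrite -sumrB; apply: eq_bigr => t _; rewrite -mxinner_symmxl //.
    by rewrite (mxinnerC _ (M t)) -mxinnerBr /M mxinnerNl -mxinnerNr opprB.
  lra.
(* With [y0] fixed and [Q] running along the ray of [w w^T] at time [t], the bound [HM] is affine in
   the ray parameter. *)
have psdM t : psd_ge (M t) 0.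
  apply/psd_ge0P => // w.
  apply: (@affine_slope_ge0 _
    (dual_obj X eps y0 + \sum_t mxinner (dual_slack X y0 t) (M t)) v) => k k0.
  have := HM y0 (fun j => if j == t then k *: (w *m w^T) else 0) dom0 box0.
  rewrite (sumr_if_eq (F := fun j => mxinner (M j))); last by move=> j; rewrite mxinner0r.
  rewrite mxinnerZr; apply=> j; case: eqP => _; last exact: psd0.
  by apply: psdZ => //; exact: psd_rank1.
exists (fun t => eps%:M + M t); split=> [|Theta pfeas]; first exact: primal_feasible_eps.
(* [HM] at [dual_subgradient] with [Q = 0] bounds the cost of [eps I + M] by the infimum [v]. *)
apply: le_trans (v_le _ pfeas); rewrite primal_obj_subgradient //.
apply: le_trans (HM _ (fun=> 0) _ _ _) _.
- by apply: dual_subgradient_domain => t; rewrite linearD /= tr_scalar_mx symM.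
- exact: dual_subgradient_box.
- by move=> t; exact: psd0.
by rewrite big1 ?addr0 // => t _; rewrite mxinner0r.
Qed.

(** * Existence of a Slater point *)

Definition slater_dZ (R : realType) (p T : nat) (X : 'I_T -> 'cV[R]_p) (c : R)
    (k : nat) : 'M[R]_p :=
  c *: ((k%:R / T%:R) *: (\sum_t X t *m (X t)^T)
        - \sum_(t < T | (t < k)%N) X t *m (X t)^T).

(* Partial sums spread the excess [c X_t X_t^T] evenly, so that every slack is
   [(c / T) sum_t X_t X_t^T - I]. *)
Definition slater_point (R : realType) (p T : nat) (X : 'I_T -> 'cV[R]_p) (c : R) :
    dualvar R p T :=
  DualVar (fun t => c *: sqrtXX X t) (fun=> 0) (fun t => slater_dZ X c t.+1).

(** At [k = 0] and [k = T] the formula itself vanishes, in agreement with the boundary convention of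
    [Zext]. *)
Lemma Zext_slater_point (R : realType) (p T : nat) (X : 'I_T -> 'cV[R]_p) (c : R) k :
  (0 < T)%N -> (k <= T)%N -> Zext (dZ (slater_point X c)) k = slater_dZ X c k.
Proof.
move=> T0; case: k => [_|k kT] /=.
  by rewrite /slater_dZ mul0r scale0r big_pred0 // subrr scaler0.
case: insubP => [t _ <-|] //=; rewrite -leqNgt => Tk.
have -> : k.+1 = T by apply/eqP; rewrite eqn_leq kT -(prednK T0).
rewrite /slater_dZ divff ?pnatr_eq0 -?lt0n // scale1r.
by under [X in _ - X]eq_bigl do rewrite ltn_ord; rewrite subrr scaler0.
Qed.

Lemma dual_slack_slater_point (R : realType) (p T : nat) (X : 'I_T -> 'cV[R]_p)
    (c : R) t :
  dual_slack X (slater_point X c) t =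
  (c / T%:R) *: (\sum_t X t *m (X t)^T) - 1%:M.
Proof.
have T0 : (0 < T)%N by exact: leq_ltn_trans (ltn_ord t).
rewrite /dual_slack !Zext_slater_point // ?(ltnW (ltn_ord t)) //= -scalemxAr.
rewrite (sqrtXXP X t).2 symmx_id; last by rewrite linearZ /= trmx_mul trmxK.
have -> : slater_dZ X c t.+1 = c *: ((t.+1%:R / T%:R) *: (\sum_t X t *m (X t)^T)
    - (X t *m (X t)^T + \sum_(i < T | (i < t)%N) X i *m (X i)^T)).
  congr (_ *: (_ - _)); rewrite (bigD1 t) ?ltnSn //=; congr (_ + _).
  by apply: eq_bigl => i; rewrite ltnS [RHS]ltn_neqAle andbC.
rewrite /slater_dZ.
set B := \sum_t X t *m (X t)^T; set S := \sum_(i < T | _) _; set x := X t *m _.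
have T1 : T%:R != 0 :> R by rewrite pnatr_eq0 -lt0n.
by apply/matrixP => i j; rewrite !mxE -natr1; field.
Qed.

Lemma dual_slater_exists (R : realType) (p T : nat) (X : 'I_T -> 'cV[R]_p) :
  pd_gt (\sum_t X t *m (X t)^T) 0 ->
  exists2 lam2bar : R, 0 < lam2bar & forall lam1 lam2 : R, 0 < lam1 ->
    lam2bar <= lam2 -> exists y : dualvar R p T, dual_slater X lam1 lam2 y.
Proof.
move=> pdB; have [b b0 Hb] := pd_gt_coercive pdB.
have [/symmetricmxP symB _ _] := pdB.
(* Then [c / T] times the coercivity constant [b] is [2], which leaves a margin of one after
   subtracting the identity. *)
pose c := 2 * T%:R / b; pose y := slater_point X c.
(* The sum dominates each norm and the [1] makes the bound strict. It does not involve [lam1],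
   because the [dY] part of the point is zero. *)
exists (1 + \sum_(t < T) frob (slater_dZ X c t.+1)) => [|lam1 lam2 lam1_0 le_lam2].
  by apply: ltr_wpDr => //; apply: sumr_ge0 => t _; exact: frob_ge0.
exists y.
have dom : dual_domain y.
  split=> t; first exact: symoff0.
  apply/symmetricmxP; rewrite /= /slater_dZ linearZ linearB linearZ /= symB.
  congr (_ *: (_ - _)); rewrite raddf_sum; apply: eq_bigr => j _ /=.
  by rewrite trmx_mul trmxK.
have strict (t : 'I_T) : [/\ pd_gt (dual_slack X y t) 0,
    frob (Zext (dZ y) t.+1) < lam2 * T%:R &
    forall u v, u != v -> `|dY y t u v| < lam1 * T%:R].
  have T0 : (0 < T)%N by exact: leq_ltn_trans (ltn_ord t).
  have T0' : 0 < T%:R :> R by rewrite ltr0n.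
  split.
  - split=> [||v v0]; try apply/symmetricmxP; rewrite ?trmx0 ?trmx_dual_slack //.
    rewrite subr0 qform_mxinner dual_slack_slater_point mxinnerBl mxinnerZl.
    have -> : c / T%:R = 2 / b by rewrite /c; field; rewrite !gt_eqF.
    have n0 := norm2_gt0 v0.
    have b2 : 0 <= 2 / b by rewrite divr_ge0 // ltW.
    have := ler_wpM2l b2 (Hb v); rewrite mulrA divfK ?gt_eqF //; lra.
  - rewrite Zext_slater_point //.
    apply: (@lt_le_trans _ _ lam2).
      apply: lt_le_trans le_lam2; rewrite (bigD1 t) //=.
      have : 0 <= \sum_(i < T | i != t) frob (slater_dZ X c i.+1).
        by apply: sumr_ge0 => i _; exact: frob_ge0.
      by lra.
    rewrite ler_peMr ?ler1n //; apply: le_trans le_lam2.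
    by apply: addr_ge0 => //; apply: sumr_ge0 => i _; exact: frob_ge0.
  - by move=> u v _; rewrite mxE normr0 mulr_gt0.
split=> //; split=> // t; have [pdt Zt Yt] := strict t; split; last 1 first.
- by move=> u v uv; apply/ltW/Yt.
- have [symS _ posS] := pdt; split=> // [|v]; first exact/symmetricmxP/trmx0.
  by have [->|/posS/ltW//] := eqVneq v 0; rewrite mulmx0 mxE.
- exact: ltW.
Qed.

(** That (D) is the dual problem is expressed pointwise on [dual_domain]: maximising [lagrange_dual]
    there amounts to maximising [dual_obj] under the constraints of (D). *)
Theorem proposition4p1 (R : realType) (p T : nat) (X : 'I_T -> 'cV[R]_p)
    (eps : R) (heps : 0 < eps) :
  (forall lam1 lam2 : R, 0 < lam1 -> 0 < lam2 ->
     (forall y : dualvar R p T, dual_domain y ->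
        (dual_feasible X lam1 lam2 y ->
           lagrange_dual X eps lam1 lam2 y = (dual_obj X eps y)%:E) /\
        (~ dual_feasible X lam1 lam2 y ->
           lagrange_dual X eps lam1 lam2 y = -oo%E)) /\
     primal_val X eps lam1 lam2 = dual_val X eps lam1 lam2) /\
  (pd_gt (\sum_t X t *m (X t)^T) 0 ->
     exists2 lam2bar : R, 0 < lam2bar &
       forall lam1 lam2 : R, 0 < lam1 -> lam2bar <= lam2 ->
         (exists y : dualvar R p T, dual_slater X lam1 lam2 y) /\
         (exists Theta : 'I_T -> 'M[R]_p,
            primal_optimal X eps lam1 lam2 Theta)).
Proof.
split=> [lam1 lam2 lam1_0 lam2_0 | /dual_slater_exists[lam2bar lam2bar0 slater]].
  split=> [y dom|]; last by apply: primal_dual_val; exact: ltW.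
  split; first exact: lagrange_dual_feasible.
  by apply: lagrange_dual_infeasible => //; exact: ltW.
exists lam2bar => // lam1 lam2 lam1_0 le_lam2.
have [y slat] := slater lam1 lam2 lam1_0 le_lam2.
split; first by exists y.
apply: slater_primal_optimal slat; first exact: ltW.
exact: le_trans (ltW lam2bar0) le_lam2.
Qed.
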